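(* Let $d$ be a fixed dimension. Given a set $S$ of $n\ge 2$ points in $\mathbb{R}^d$, one can find in $O(n\log n)$ time two curves $P,Q$ that partition $S$ such that the discrete Fréchet distance $d_{dF}(P,Q)$ is minimized among all pairs of curves that partition $S$.
   Context: A (polygonal) curve is given by its finite non-empty sequence of vertices. Two curves $P,Q$ partition a finite point set $S$ if there is a partition of $S$ into two sets $A,B$ such that the vertex set of $P$ is exactly $A$, the vertex set of $Q$ is exactly $B$, and each point of $S$ is used exactly once (either in $P$ or in $Q$). A paired-walk along $P$ and $Q$ is a sequence of pairs $\pi=\{(P_i,Q_i)\}_{i=1}^k$ such that $P_1,\dots,P_k$ and $Q_1,\dots,Q_k$ partition the vertex sequences of $P$ and $Q$, respectively, in order, into disjoint non-empty contiguous subsequences, and for every $i$ either $|P_i|=1$ or $|Q_i|=1$. Its cost is $\max_i\max_{(p,q)\in P_i\times Q_i}\|p-q\|$ (Euclidean norm). The discrete Fréchet distance $d_{dF}(P,Q)$ is the minimum cost of a paired-walk along $P$ and $Q$. *)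

(* Defs.v *)
From HB Require Import structures.
From mathcomp Require Import all_boot all_order all_algebra.
From mathcomp Require Import finmap.
From mathcomp Require Import all_classical all_reals all_analysis.

Set Implicit Arguments.
Unset Strict Implicit.
Unset Printing Implicit Defensive.

Import Order.TTheory GRing.Theory Num.Theory.
Import numFieldNormedType.Exports.

Local Open Scope classical_set_scope.
Local Open Scope ring_scope.

(* A curve is the sequence of its vertices; non-emptiness is required where
   curves are quantified over. *)
Section Curves.
Variables (R : realType) (d : nat).
Implicit Types (P Q : seq 'rV[R]_d).

(* The norm that the library puts on 'rV[R]_d is the sup norm. *)
Definition edist (u v : 'rV[R]_d) : R :=
  Num.sqrt (\sum_(i < d) (u 0 i - v 0 i) ^+ 2).

Definition curves_partition (S : {fset 'rV[R]_d}) P Q : Prop :=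
  [/\ P != [::], Q != [::] &
    exists A B : {fset 'rV[R]_d},
      [/\ S = (A `|` B)%fset, (A `&` B)%fset = fset0,
          P =i A /\ uniq P & Q =i B /\ uniq Q]].

Definition paired_walk P Q (w : seq (seq 'rV[R]_d * seq 'rV[R]_d)) : Prop :=
  [/\ flatten [seq b.1 | b <- w] = P,
      flatten [seq b.2 | b <- w] = Q &
      forall b, b \in w ->
        [/\ b.1 != [::], b.2 != [::] & (size b.1 == 1)%N || (size b.2 == 1)%N]].

Definition walk_cost (w : seq (seq 'rV[R]_d * seq 'rV[R]_d)) : R :=
  \big[Num.max/0]_(b <- w) \big[Num.max/0]_(p <- b.1)
    \big[Num.max/0]_(q <- b.2) edist p q.

(* For non-empty curves this infimum is a minimum, see [dF_min]. *)
Definition dF P Q : R := inf [set walk_cost w | w in paired_walk P Q].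

Lemma paired_walk_exists P Q :
  P != [::] -> Q != [::] -> exists w, paired_walk P Q w.
Proof.
case: P => [//|p [|p' P]] _; case: Q => [//|q [|q' Q]] _.
- by exists [:: ([:: p], [:: q])]; split=> //= b; rewrite inE => /eqP->.
- exists [:: ([:: p], [:: q, q' & Q])]; split; rewrite /= ?cats0 // => b.
  by rewrite inE => /eqP->.
- exists [:: ([:: p, p' & P], [:: q])]; split; rewrite /= ?cats0 // => b.
  by rewrite inE => /eqP->.
- exists [:: ([:: p], belast q (q' :: Q)); (p' :: P, [:: last q' Q])].
  split; rewrite /= ?cats0 //.
    by rewrite cats1 -lastI.
  by move=> b; rewrite !inE => /orP[]/eqP->; split; rewrite //= orbT.
Qed.

Lemma bigmax_in (I : eqType) (r : seq I) (F : I -> R) (L : seq R) :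
  0 \in L -> (forall i, i \in r -> F i \in L) ->
  \big[Num.max/0]_(i <- r) F i \in L.
Proof.
move=> L0 FL; rewrite big_seq; elim/big_ind: _ => // x y xL yL.
by rewrite maxEle; case: ifP.
Qed.

Lemma walk_cost_in P Q w : paired_walk P Q w ->
  walk_cost w \in 0 :: [seq edist p q | p <- P, q <- Q].
Proof.
case=> wP wQ _; apply: bigmax_in => [|b bw]; first exact: mem_head.
apply: bigmax_in => [|p pb]; first exact: mem_head.
apply: bigmax_in => [|q qb]; first exact: mem_head.
rewrite inE; apply/orP; right; apply: allpairs_f.
  by rewrite -wP; apply/flattenP; exists b.1 => //; apply: map_f.
by rewrite -wQ; apply/flattenP; exists b.2 => //; apply: map_f.
Qed.

Lemma finite_min (L : seq R) (E : set R) : E !=set0 ->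
  (forall x, E x -> x \in L) -> exists2 m, E m & forall x, E x -> m <= x.
Proof.
move=> [a Ea] EL; pose s := [seq x <- L | `[< E x >]].
have sE x : E x -> x \in s.
  by move=> Ex; rewrite mem_filter EL // andbT; apply/asboolP.
have sall : all (fun x => `[< E x >]) s by exact: filter_all.
have aE : a \in s by exact: sE.
have : sorted <=%R (sort <=%R s) by apply: sort_sorted; exact: le_total.
have := mem_sort <=%R s; case: (sort <=%R s) => [|m t] ms.
  by move: aE; rewrite -ms.
move=> /= tm; exists m.
  by apply/asboolP; apply: (allP sall); rewrite -ms mem_head.
move=> x /sE; rewrite -ms inE => /orP[/eqP-> //|xt].
by move: tm; rewrite (path_sortedE le_trans) => /andP[/allP/(_ _ xt)].
Qed.

Lemma dF_min P Q : P != [::] -> Q != [::] ->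
  (exists2 w, paired_walk P Q w & walk_cost w = dF P Q) /\
  (forall w, paired_walk P Q w -> dF P Q <= walk_cost w).
Proof.
move=> P0 Q0; have [w0 ww0] := paired_walk_exists P0 Q0.
have [||m [w ww <-] wmin] := @finite_min
  (0 :: [seq edist p q | p <- P, q <- Q]) [set walk_cost w | w in paired_walk P Q].
- by exists (walk_cost w0), w0.
- by move=> _ [w ww <-]; exact: walk_cost_in.
have lb w' : paired_walk P Q w' -> walk_cost w <= walk_cost w'.
  by move=> ww'; apply: wmin; exists w'.
suff -> : dF P Q = walk_cost w by split=> //; exists w.
apply/eqP; rewrite eq_le; apply/andP; split.
  apply: ge_inf; last by exists w.
  by exists (walk_cost w) => _ [w' ww' <-]; exact: lb.
by apply: lb_le_inf; [exists (walk_cost w), w | move=> _ [w' ww' <-]; exact: lb].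
Qed.

End Curves.

(* Model of computation: the real RAM of Preparata and Shamos, as a
   structured programming language.  Every instruction and every evaluation of
   a test costs one unit of time.

   A memory cell holds either a real or a natural number (used as counter or
   address).  Reals admit only the constants 0 and 1, the four field operations
   and comparison: there is no rounding, no conversion between reals and
   naturals, and no root.  Naturals admit only literals, addition, truncated
   subtraction and comparison.  Division by zero yields zero.

   There are registers of both kinds, and numbered arrays of both kinds.  The
   numbers of registers and arrays are literals of the program text; the only
   indirect access is [a[x]] with [a] an array and [x] a natural register. *)
Inductive instr : Type :=
| NLit (x k : nat)
| NCopy (x y : nat)
| NAdd (x y z : nat)
| NSub (x y z : nat)
| NLoad (x a i : nat)
| NStore (a i x : nat)
| RZero (x : nat)
| ROne (x : nat)
| RCopy (x y : nat)
| RAdd (x y z : nat)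
| RSub (x y z : nat)
| RMul (x y z : nat)
| RDiv (x y z : nat)
| RLoad (x a i : nat)
| RStore (a i x : nat).

Inductive test : Type :=
| NLt (x y : nat)
| REq (x y : nat)
| RLt (x y : nat).

Inductive cmd : Type :=
| Skip
| Instr (i : instr)
| Seq (c1 c2 : cmd)
| If (b : test) (c1 c2 : cmd)
| While (b : test) (c : cmd).

Section Semantics.
Variable R : realType.

Record state : Type := State {
  nreg : nat -> nat;
  rreg : nat -> R;
  narr : nat -> nat -> nat;
  rarr : nat -> nat -> R }.

Definition upd (T : Type) (f : nat -> T) (x : nat) (v : T) : nat -> T :=
  fun y => if y == x then v else f y.

Definition set_nreg (s : state) x v :=
  State (upd (nreg s) x v) (rreg s) (narr s) (rarr s).
Definition set_rreg (s : state) x v :=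
  State (nreg s) (upd (rreg s) x v) (narr s) (rarr s).
Definition set_narr (s : state) a i v :=
  State (nreg s) (rreg s) (upd (narr s) a (upd (narr s a) i v)) (rarr s).
Definition set_rarr (s : state) a i v :=
  State (nreg s) (rreg s) (narr s) (upd (rarr s) a (upd (rarr s a) i v)).

Definition step (i : instr) (s : state) : state :=
  match i with
  | NLit x k => set_nreg s x k
  | NCopy x y => set_nreg s x (nreg s y)
  | NAdd x y z => set_nreg s x (nreg s y + nreg s z)%N
  | NSub x y z => set_nreg s x (nreg s y - nreg s z)%N
  | NLoad x a i => set_nreg s x (narr s a (nreg s i))
  | NStore a i x => set_narr s a (nreg s i) (nreg s x)
  | RZero x => set_rreg s x 0
  | ROne x => set_rreg s x 1
  | RCopy x y => set_rreg s x (rreg s y)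
  | RAdd x y z => set_rreg s x (rreg s y + rreg s z)
  | RSub x y z => set_rreg s x (rreg s y - rreg s z)
  | RMul x y z => set_rreg s x (rreg s y * rreg s z)
  | RDiv x y z => set_rreg s x (rreg s y / rreg s z)
  | RLoad x a i => set_rreg s x (rarr s a (nreg s i))
  | RStore a i x => set_rarr s a (nreg s i) (rreg s x)
  end.

Definition holds (b : test) (s : state) : bool :=
  match b with
  | NLt x y => (nreg s x < nreg s y)%N
  | REq x y => rreg s x == rreg s y
  | RLt x y => rreg s x < rreg s y
  end.

(* [exec c s t s']: started in s, c halts in s' after t units of time. *)
Inductive exec : cmd -> state -> nat -> state -> Prop :=
| ExecSkip s : exec Skip s 1 s
| ExecInstr i s : exec (Instr i) s 1 (step i s)
| ExecSeq c1 c2 s1 t1 s2 t2 s3 :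
    exec c1 s1 t1 s2 -> exec c2 s2 t2 s3 -> exec (Seq c1 c2) s1 (t1 + t2)%N s3
| ExecIf b c1 c2 s t s' :
    exec (if holds b s then c1 else c2) s t s' -> exec (If b c1 c2) s t.+1 s'
| ExecWhileDone b c s : ~~ holds b s -> exec (While b c) s 1 s
| ExecWhileStep b c s1 t1 s2 t2 s3 :
    holds b s1 -> exec c s1 t1 s2 -> exec (While b c) s2 t2 s3 ->
    exec (While b c) s1 (t1 + t2).+1%N s3.

Lemma exec_det c s t1 s1 t2 s2 :
  exec c s t1 s1 -> exec c s t2 s2 -> t1 = t2 /\ s1 = s2.
Proof.
move=> e1; elim: e1 t2 s2 => {c s t1 s1}
  [s|i s|c1 c2 s1 t1 s2 t2 s3 _ IH1 _ IH2|b c1 c2 s t s' _ IH|b c s bN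
  |b c s1 t1 s2 t2 s3 bs _ IH1 _ IH2] u v e2; inversion e2; subst => //.
- match goal with h1 : exec c1 _ _ _, h2 : exec c2 _ _ _ |- _ =>
    case: (IH1 _ _ h1) => ? ?; subst; case: (IH2 _ _ h2) => ? ?; subst end.
  by [].
- match goal with h1 : exec _ _ _ _ |- _ => case: (IH _ _ h1) => -> -> end.
  by [].
- by match goal with h : is_true (~~ _), h' : is_true (holds _ _) |- _ =>
    rewrite h' in h end.
- by match goal with h : is_true (~~ _), h' : is_true (holds _ _) |- _ =>
    rewrite h' in h end.
- match goal with h1 : exec c _ _ _, h2 : exec (While _ _) _ _ _ |- _ =>
    case: (IH1 _ _ h1) => ? ?; subst;
    case: (IH2 _ _ h2) => ? ?; subst end.
  by [].
Qed.

(* The k-th point list of the memory, l: its length is in the natural register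
   k, and the j-th coordinates of its points form the real array k * d + j. *)
Definition stores (d : nat) (s : state) (k : nat) (l : seq 'rV[R]_d) : Prop :=
  nreg s k = size l /\
  forall (i : nat) (j : 'I_d), (i < size l)%N ->
    rarr s (k * d + j)%N i = nth 0 l i 0 j.

End Semantics.

(* Main.v *)
Require Import Defs.
From mathcomp Require Import all_boot all_order all_algebra.
From mathcomp Require Import finmap.
From mathcomp Require Import all_classical all_reals all_analysis.
From mathcomp Require Import zify ring lra.
Import Order.TTheory GRing.Theory Num.Theory.
Import numFieldNormedType.Exports.
Local Open Scope classical_set_scope.
Local Open Scope ring_scope.

(* Call D the largest nearest-neighbour distance in S.  In a paired walk every
   point is paired with a point of the other curve, so no pair of curves is
   better than D.  Conversely, join every point to a partner at distance at most
   D; a graph without isolated vertices has a spanning forest of stars, and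
   walking through the stars, centres on P and leaves on Q, costs at most D.

   Partners within D are found in O(n log n) time as follows.  For a width w, cut
   each axis greedily, along the sorted coordinates, into cells of width w.  A
   point that is not alone in its cell has a neighbour at distance <= d w, and a
   point alone in its cell is compared with all the points of the (4d+1)^d
   surrounding cells.  As a cell is scanned by boundedly many lone points, this
   takes linear time; it decides whether D <= 2 d w, and when d w < D <= 2 d w the
   partners found are within D.  To reach such a w, note that D is, up to a factor
   polynomial in n, one of the gaps between consecutive values of a coordinate:
   bisect the sorted gaps, then double w, O(log n) times in all. *)

Set Implicit Arguments.
Unset Strict Implicit.
Unset Printing Implicit Defensive.

(** * Total correctness with a time bound *)

Notation "a ;; b" := (Seq a b) (at level 90, right associativity).
Coercion Instr : instr >-> cmd.

(** The machine shapes the algorithm. It takes no roots, so distances are handled through their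
    squares: from here on [D] is the square of the distance so named in the overview, and a factor d
    stands where the root of d would do. It cannot round, so a point cannot be placed in a uniform
    grid by division; hence the cuts along sorted axes. The resulting cells are irregular, but their
    left ends are more than w apart, so coordinates within 2dw have cell numbers differing by at
    most 2d; this is the origin of 4d+1. Cells are addressed directly, in a table with about n^d
    entries that could not be cleared within the time bound. Distances would be quadratically many
    candidates for the width; gaps are only d n. They suffice because the point whose nearest
    neighbour is farthest differs from that neighbour, on each axis, by a sum of fewer than n gaps,
    none of which exceeds their distance. The width is tested against 2dw while cellmates are within
    dw because the last doubling then ends well: d times the new width is 2d times the rejected
    one. *)

Fixpoint wnreg (x : nat) (c : cmd) : bool :=
  match c with
  | Instr (NLit y _) | Instr (NCopy y _) | Instr (NAdd y _ _)
  | Instr (NSub y _ _) | Instr (NLoad y _ _) => x == y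
  | Seq c1 c2 | If _ c1 c2 => wnreg x c1 || wnreg x c2
  | While _ c1 => wnreg x c1
  | _ => false
  end.

Fixpoint wrreg (x : nat) (c : cmd) : bool :=
  match c with
  | Instr (RZero y) | Instr (ROne y) | Instr (RCopy y _)
  | Instr (RAdd y _ _) | Instr (RSub y _ _) | Instr (RMul y _ _)
  | Instr (RDiv y _ _) | Instr (RLoad y _ _) => x == y
  | Seq c1 c2 | If _ c1 c2 => wrreg x c1 || wrreg x c2
  | While _ c1 => wrreg x c1
  | _ => false
  end.

Fixpoint wnarr (x : nat) (c : cmd) : bool :=
  match c with
  | Instr (NStore y _ _) => x == y
  | Seq c1 c2 | If _ c1 c2 => wnarr x c1 || wnarr x c2
  | While _ c1 => wnarr x c1
  | _ => false
  end.

Fixpoint wrarr (x : nat) (c : cmd) : bool :=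
  match c with
  | Instr (RStore y _ _) => x == y
  | Seq c1 c2 | If _ c1 c2 => wrarr x c1 || wrarr x c2
  | While _ c1 => wrarr x c1
  | _ => false
  end.

#[global] Arguments upd {T} f x v y /.

Section Frame.
Variable R : realType.
Implicit Types (s : state R) (c : cmd).

Definition frame c s s' :=
  [/\ forall x, ~~ wnreg x c -> nreg s' x = nreg s x,
      forall x, ~~ wrreg x c -> rreg s' x = rreg s x,
      forall x, ~~ wnarr x c -> narr s' x = narr s x &
      forall x, ~~ wrarr x c -> rarr s' x = rarr s x].

(** The write sets are computed from the program text, so that the survival of a register or array
    across a concrete program is closed by [isT]; only [unroll] over the variable d needs the four
    rewriting lemmas further down. *)
Lemma exec_frame c s t s' : exec c s t s' -> frame c s s'.
Proof.
elim=> {c s t s'} [s|i s|c1 c2 s1 t1 s2 t2 s3 _ [a1 a2 a3 a4] _ [b1 b2 b3 b4]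
  |b c1 c2 s t s' _ [a1 a2 a3 a4]|b c s _|b c s1 t1 s2 t2 s3 _ _ [a1 a2 a3 a4] _ [b1 b2 b3 b4]].
- by split.
- by case: i => *; split=> z //= /negPf nz; rewrite /upd nz.
- by split=> x /= /norP[n1 n2]; rewrite ?(b1, b2, b3, b4) ?(a1, a2, a3, a4).
- by split=> x /= /norP[n1 n2]; (rewrite a1 || rewrite a2 || rewrite a3 || rewrite a4) => //;
    case: ifP.
- by split.
- by split=> x /= n1; rewrite ?(b1, b2, b3, b4) ?(a1, a2, a3, a4).
Qed.

Definition run c s t (Q : state R -> Prop) :=
  exists t' s', [/\ exec c s t' s', (t' <= t)%N & Q s'].

Lemma run_frame c s t Q :
  run c s t Q -> run c s t (fun s' => Q s' /\ frame c s s').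
Proof.
by move=> [t' [s' [e le q]]]; exists t', s'; split=> //; split=> //; exact: exec_frame e.
Qed.

Lemma run_mono c s t t' (Q Q' : state R -> Prop) :
  run c s t Q -> (t <= t')%N -> (forall s', Q s' -> Q' s') -> run c s t' Q'.
Proof.
move=> [u [s' [e le q]]] le' QQ; exists u, s'; split=> //; last exact: QQ.
exact: leq_trans le'.
Qed.

Lemma run_use c s t t' (Q Q' : state R -> Prop) :
  run c s t Q -> (t <= t')%N -> (forall s', Q s' -> frame c s s' -> Q' s') ->
  run c s t' Q'.
Proof. by move=> /run_frame r le QQ; apply: (run_mono r le) => s' []; exact: QQ. Qed.

Lemma run_skip s t Q : (0 < t)%N -> Q s -> run Skip s t Q.
Proof. by move=> t0 q; exists 1%N, s; split=> //; constructor. Qed.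

Lemma run_instr i s t (Q : state R -> Prop) :
  (0 < t)%N -> Q (step i s) -> run (Instr i) s t Q.
Proof. by move=> t0 q; exists 1%N, (step i s); split=> //; constructor. Qed.

Lemma run_seq c1 c2 s t1 t2 t Q :
  run c1 s t1 (fun s' => run c2 s' t2 Q) -> (t1 + t2 <= t)%N ->
  run (c1 ;; c2) s t Q.
Proof.
move=> [u [s1 [e1 l1 [v [s2 [e2 l2 q]]]]]] le.
exists (u + v)%N, s2; split=> //; first by econstructor; eauto.
by apply: leq_trans le; exact: leq_add.
Qed.

Lemma run_cons i c s t Q : run c (step i s) t Q -> run (Instr i ;; c) s t.+1 Q.
Proof.
by move=> r; apply: (@run_seq _ _ _ 1 t) => //; apply: run_instr.
Qed.

(** Named subprograms occur as left operands of [;;], while [run_cons] peels off a single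
    instruction at the front. *)
Lemma run_assoc a b c s t Q : run (a ;; b ;; c) s t Q -> run ((a ;; b) ;; c) s t Q.
Proof.
move=> [t' [s' [ex le q]]]; exists t', s'; split=> //.
inversion ex; subst; match goal with h : exec (b ;; c) _ _ _ |- _ => inversion h; subst end.
by rewrite addnA; do 2!(econstructor; eauto).
Qed.

Lemma run_if b c1 c2 s t Q :
  (holds b s -> run c1 s t Q) -> (holds b s = false -> run c2 s t Q) ->
  run (If b c1 c2) s t.+1 Q.
Proof.
move=> r1 r2; case: (boolP (holds b s)) => [h|/negPf h];
  [have := r1 h|have := r2 h]; move=> [u [s' [e le q]]];
  by exists u.+1, s'; split=> //; constructor; rewrite h.
Qed.

(* The first argument of [I] is the time budget left. *)
Lemma run_while b c (I : nat -> state R -> Prop) s u :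
  I u s ->
  (forall u s, I u s -> (0 < u)%N) ->
  (forall u s, I u s -> holds b s ->
     exists t, run c s t (fun s' => exists2 u', I u' s' & (t + u' < u)%N)) ->
  run (While b c) s u (fun s' => (exists u', I u' s') /\ holds b s' = false).
Proof.
move=> + I0 step; elim/ltn_ind: u s => u IH s Iu.
case: (boolP (holds b s)) => h; last first.
  exists 1%N, s; split; [by constructor | exact: I0 Iu |].
  by split; [exists u | exact: negPf].
have [t [t1 [s1 [e1 l1 [u' Iu' lt]]]]] := step u s Iu h.
have u'u : (u' < u)%N by apply: leq_ltn_trans lt; exact: leq_addl.
have [t2 [s2 [e2 l2 q]]] := IH u' u'u s1 Iu'.
exists (t1 + t2).+1, s2; split=> //; first by econstructor; eauto.
by apply: leq_ltn_trans lt; exact: leq_add.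
Qed.

Lemma run_mid c1 c2 s t1 t2 t (M Q : state R -> Prop) :
  run c1 s t1 M -> (forall s', M s' -> frame c1 s s' -> run c2 s' t2 Q) ->
  (t1 + t2 <= t)%N -> run (c1 ;; c2) s t Q.
Proof. by move=> r1 r2; apply: run_seq; apply: (run_use r1). Qed.

End Frame.

(* Throughout, register 0 holds n, register 3 holds 0 and register 4 holds 1. *)
Definition For (i m : nat) (c : cmd) : cmd :=
  NLit i 0 ;; While (NLt i m) (c ;; NAdd i i 4).

(** [I] has to ignore the counter register, since the body reaches [I k.+1] before the counter is
    increased. The budget [tb k] may vary with k, on which the amortised bounds rely. Each round
    adds 2 for the test and the increment; the final 2 pays for the initialisation and the last
    test. *)
Lemma run_for (R : realType) (i m : nat) c (I : nat -> state R -> Prop) (tb : nat -> nat) s N t Q :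
  nreg s m = N -> nreg s 4 = 1%N -> i != m -> i != 4%N ->
  ~~ wnreg i c -> ~~ wnreg m c -> ~~ wnreg 4 c ->
  (forall k s v, I k s -> I k (set_nreg s i v)) ->
  I 0 s ->
  (forall k s', (k < N)%N -> nreg s' i = k -> nreg s' m = N -> nreg s' 4 = 1%N ->
      I k s' -> run c s' (tb k) (I k.+1)) ->
  (\sum_(k < N) (tb k + 2) + 2 <= t)%N ->
  (forall s', I N s' -> Q s') ->
  run (For i m c) s t Q.
Proof.
move=> sm s4 im i4 wi wm w4 Iset I0 body le IQ.
pose J u (s' : state R) := exists k, [/\ (k <= N)%N, nreg s' i = k, nreg s' m = N,
  nreg s' 4 = 1%N & I k s' /\ u = (\sum_(k <= l < N) (tb l + 2) + 1)%N].
apply: (@run_mono _ _ _ (\sum_(k < N) (tb k + 2) + 2) _ _ _ _ le); last exact: IQ.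
rewrite addn2 -addn1; apply: run_cons.
apply: (@run_mono _ _ _ _ _ _ _ (@run_while _ _ _ J _ (\sum_(k < N) (tb k + 2) + 1) _ _ _)) => //.
- exists 0%N; split=> //=; rewrite /upd ?eqxx // ?[m == i]eq_sym ?[4 == i]eq_sym
    ?(negPf im) ?(negPf i4) //; split; first exact: Iset.
  by rewrite big_mkord.
- by move=> u s' [k [_ _ _ _ [_ ->]]]; rewrite addn1.
- move=> u s' [k [kN s'i s'm s'4 [Ik ->]]] /=; rewrite s'i s'm => kN'.
  exists (tb k + 1)%N; apply: (run_seq (t2:=1)); last by [].
  apply: (run_use (body _ _ kN' s'i s'm s'4 Ik)) => // s2 Ik1 [fr _ _ _].
  apply: run_instr => //; exists (\sum_(k.+1 <= l < N) (tb l + 2) + 1)%N.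
    exists k.+1; split=> //=; rewrite /upd ?eqxx ?[m == i]eq_sym ?[4 == i]eq_sym
      ?(negPf im) ?(negPf i4) ?fr //; first by rewrite s'4 s'i addn1.
    by split=> //; exact: Iset.
  by rewrite (big_ltn kN'); lia.
- move=> s' [[u [k [kN s'i s'm _ [Ik _]]]]] /=; rewrite s'i s'm => /negbT; rewrite -leqNgt => Nk.
  by have -> : N = k by apply/eqP; rewrite eqn_leq Nk.
Qed.

(** Array numbers are literals of the program text, so a loop over the coordinates has to be
    unrolled; d is a constant of the program. *)
Fixpoint unroll (c : nat -> cmd) (d : nat) : cmd :=
  if d is d'.+1 then (unroll c d' ;; c d') else Skip.

Lemma run_unroll (R : realType) c (I : nat -> state R -> Prop) d tb s t Q :
  I 0 s -> (forall j s, (j < d)%N -> I j s -> run (c j) s tb (I j.+1)) ->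
  (d * tb + 1 <= t)%N -> (forall s', I d s' -> Q s') ->
  run (unroll c d) s t Q.
Proof.
move=> I0 body le IQ; apply: (@run_mono _ _ _ (d * tb + 1)%N _ (I d)) => //.
elim: d body {le IQ} => [|d IH] body /=; first exact: run_skip.
apply: (@run_seq _ _ _ _ (d * tb + 1) tb); last by rewrite mulSn; lia.
apply: (run_mono (IH _)) => //; first by move=> j s' jd; apply: body; exact: ltnW.
by move=> s'; exact: body.
Qed.

Lemma wnreg_unroll x c d : (forall j, (j < d)%N -> wnreg x (c j) = false) ->
  wnreg x (unroll c d) = false.
Proof. by elim: d => //= d IH h; rewrite h ?IH // => j jd; apply: h; exact: ltnW. Qed.

Lemma wrreg_unroll x c d : (forall j, (j < d)%N -> wrreg x (c j) = false) ->
  wrreg x (unroll c d) = false.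
Proof. by elim: d => //= d IH h; rewrite h ?IH // => j jd; apply: h; exact: ltnW. Qed.

Lemma wnarr_unroll x c d : (forall j, (j < d)%N -> wnarr x (c j) = false) ->
  wnarr x (unroll c d) = false.
Proof. by elim: d => //= d IH h; rewrite h ?IH // => j jd; apply: h; exact: ltnW. Qed.

Lemma wrarr_unroll x c d : (forall j, (j < d)%N -> wrarr x (c j) = false) ->
  wrarr x (unroll c d) = false.
Proof. by elim: d => //= d IH h; rewrite h ?IH // => j jd; apply: h; exact: ltnW. Qed.

Lemma sum_const_time N a : (\sum_(k < N) a = N * a)%N.
Proof. by rewrite sum_nat_const card_ord. Qed.

(** * Linked lists of indices in an array *)

Section Linked.
Implicit Types (nxt key : nat -> nat) (l : seq nat).

(** The length n serves as the null pointer: it is the first number that is no index, so one test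
    against n ends a traversal. *)
Fixpoint linked nxt (n y : nat) l : Prop :=
  if l is a :: l' then [/\ y = a, (a < n)%N & linked nxt n (nxt a) l'] else y = n.

(** Decreasing order is the order of the chains, since [insert] puts each new index in front. *)
Fixpoint cell key (q m : nat) : seq nat :=
  if m is m'.+1 then if key m' == q then m' :: cell key q m' else cell key q m'
  else [::].

Lemma cell_lt key q m y : y \in cell key q m -> (y < m)%N && (key y == q).
Proof.
elim: m => //= m IH; case: (eqVneq (key m) q) => e; rewrite ?inE; last first.
  by move=> /IH /andP[ym ->]; rewrite ltnS ltnW.
by case/orP => [/eqP-> | /IH /andP[ym ->]]; rewrite ?ltnSn ?e ?eqxx // ltnS ltnW.
Qed.

Lemma cellE key q m y : (y \in cell key q m) = (y < m)%N && (key y == q).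
Proof.
apply/idP/idP => [/cell_lt //|]; elim: m => //= m IH; rewrite ltnS leq_eqVlt.
case: (eqVneq y m) => [->|ym] /=; first by move=> /eqP->; rewrite eqxx mem_head.
by move=> /IH yl; case: ifP => // _; rewrite inE yl orbT.
Qed.

Lemma cell_uniq key q m : uniq (cell key q m).
Proof. by elim: m => //= m IH; case: ifP => //= _; rewrite IH cellE ltnn. Qed.

Lemma linked_upd nxt n y l a v : a \notin l -> linked (upd nxt a v) n y l <-> linked nxt n y l.
Proof.
elim: l y => //= b l IH y; rewrite inE negb_or => /andP[ab al].
by rewrite eq_sym (negPf ab); split=> -[-> bn] /(IH _ al).
Qed.

End Linked.

Lemma run_list (R : realType) (y m nx : nat) c nxt n (I : seq nat -> state R -> Prop) l s tb t Q :
  y != m -> ~~ wnreg y c -> ~~ wnreg m c -> ~~ wnarr nx c ->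
  nreg s m = n -> narr s nx = nxt -> linked nxt n (nreg s y) l ->
  (forall l s v, I l s -> I l (set_nreg s y v)) ->
  I l s ->
  (forall a l' s', nreg s' y = a -> nreg s' m = n -> narr s' nx = nxt -> a \in l ->
     I (a :: l') s' -> run c s' tb (I l')) ->
  (size l * (tb + 2) + 1 <= t)%N ->
  (forall s', I [::] s' -> Q s') ->
  run (While (NLt y m) (c ;; NLoad y nx y)) s t Q.
Proof.
move=> ym wy wm wn sm sn lk Iset Il body le IQ.
pose J u (s' : state R) := exists l' : seq nat, [/\ {subset l' <= l}, linked nxt n (nreg s' y) l', nreg s' m = n,
  narr s' nx = nxt & I l' s' /\ u = (size l' * (tb + 2) + 1)%N].
apply: (@run_mono _ _ _ _ _ _ _ (@run_while _ _ _ J _ (size l * (tb + 2) + 1) _ _ _) le).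
- exists l; split=> //.
- by move=> u s' [l' [_ _ _ _ [_ ->]]]; rewrite addn1.
- move=> u s' [[|a l'] [sub lk' s'm s'n [Il' ->]]] /=; rewrite s'm.
    by move: lk' => /= ->; rewrite ltnn.
  move: lk' => /= [ya an lk'] _; exists (tb + 1)%N.
  apply: (run_seq (t2:=1)); last by [].
  have al : a \in l by apply: sub; exact: mem_head.
  apply: (run_use (body _ _ _ ya s'm s'n al Il')) => // s2 I2 [f1 _ f3 _].
  apply: run_instr => //; exists (size l' * (tb + 2) + 1)%N; last by rewrite /= mulSn; lia.
  exists l'; split=> //=.
  - by move=> z zl; apply: sub; rewrite inE zl orbT.
  - by rewrite /upd eqxx f1 // f3 // ya s'n.
  - by rewrite /upd [m == y]eq_sym (negPf ym) f1.
  - by rewrite f3.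
  - by split=> //; exact: Iset.
- move=> s' [[u [[|a l'] [_ lk' s'm _ [Il' _]]]]] /=; first by move=> _; exact: IQ.
  by move: lk' => /= [-> an _]; rewrite s'm an.
Qed.

(** * Sorting indices by a real key *)

Section Heapsort.
Local Open Scope nat_scope.

(* Array A is permuted; its entries are indices into the real array r of keys.
   Register 10 is the size of the heap, register 11 the node to be sifted. *)
Definition sift (A r : nat) : cmd :=
  NAdd 12 11 11 ;; NAdd 12 12 4 ;;
  While (NLt 12 10)
   (NAdd 16 12 4 ;; NLoad 13 A 12 ;; RLoad 2 r 13 ;;
    If (NLt 16 10)
      (NLoad 14 A 16 ;; RLoad 3 r 14 ;;
       If (RLt 2 3) (NCopy 12 16 ;; NCopy 13 14 ;; RCopy 2 3) Skip)
      Skip ;;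
    NLoad 14 A 11 ;; RLoad 3 r 14 ;;
    If (RLt 3 2)
      (NStore A 11 13 ;; NStore A 12 14 ;; NCopy 11 12 ;;
       NAdd 12 11 11 ;; NAdd 12 12 4)
      (NCopy 12 10)).

Variables (R : realType).
Implicit Types (s : state R).

(** An explicit injective re-indexing rather than equality of multisets: composition gives
    transitivity, range and distinctness of the entries transfer at once, and the identity from m on
    says that sifting leaves the sorted tail alone. *)
Definition permuted_below (m : nat) (a a' : nat -> nat) :=
  exists g : nat -> nat, [/\ injective g, forall i, i < m -> g i < m,
    forall i, m <= i -> g i = i & forall i, a' i = a (g i)].

Lemma permuted_refl m a : permuted_below m a a.
Proof. by exists id; split. Qed.

Lemma permuted_trans m a b c :
  permuted_below m a b -> permuted_below m b c -> permuted_below m a c.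
Proof.
move=> [g [gi gm ge ga]] [h [hi hm he hb]]; exists (g \o h); split=> [||i mi|i] /=.
- exact: inj_comp.
- by move=> i im; apply/gm/hm.
- by rewrite he // ge.
- by rewrite hb ga.
Qed.

Lemma permuted_le m m' a b : m <= m' -> permuted_below m a b -> permuted_below m' a b.
Proof.
move=> le [g [gi gm ge ga]]; exists g; split=> // i im; last by apply: ge; lia.
by case: (ltnP i m) => im'; [have := gm _ im'; lia | rewrite ge].
Qed.

Lemma permuted_swap m a p q : p < m -> q < m ->
  permuted_below m a (upd (upd a p (a q)) q (a p)).
Proof.
move=> pm qm; exists (fun i => if i == q then p else if i == p then q else i).
split=> [i j|i im|i mi|i].
- by do !case: eqP; lia.
- by do !case: eqP.
- by do !case: eqP; lia.
- by rewrite /upd; case: eqP => // _; case: eqP => // ->.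
Qed.

Section Order.
Variable (key : nat -> R).

Definition heap_from (lo m : nat) (a : nat -> nat) :=
  forall i c, lo <= i -> (c = i.*2.+1 \/ c = i.*2.+2) -> c < m ->
    (key (a c) <= key (a i))%R.

(** The order may fail only between p and its children. The second clause compares the parent of p
    with the children of p, so that promoting a child keeps the order above it. Nodes below [lo] are
    unconstrained as parents, which is the situation while the heap is being built. *)
Definition heap_but (lo m p : nat) (a : nat -> nat) :=
  (forall i c, lo <= i -> i <> p -> (c = i.*2.+1 \/ c = i.*2.+2) -> c < m ->
    (key (a c) <= key (a i))%R) /\
  (forall i c, lo <= i -> (p = i.*2.+1 \/ p = i.*2.+2) ->
    (c = p.*2.+1 \/ c = p.*2.+2) -> c < m -> (key (a c) <= key (a i))%R).

Lemma heap_but_leaf lo m p a : m <= p.*2.+1 -> heap_but lo m p a -> heap_from lo m a.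
Proof.
move=> mp [h _] i c loi ci cm; apply: (h i c) => // ip; subst i; lia.
Qed.

Lemma heap_but_stop lo m p a : heap_but lo m p a ->
  (forall c, (c = p.*2.+1 \/ c = p.*2.+2) -> c < m -> (key (a c) <= key (a p))%R) ->
  heap_from lo m a.
Proof.
move=> [h _] hp i c loi ci cm; case: (eqVneq i p) => [ip|/eqP ip].
  by subst i; exact: hp.
exact: h ip ci cm.
Qed.

Lemma heap_but_step lo m p c a : heap_but lo m p a -> lo <= p ->
  (c = p.*2.+1 \/ c = p.*2.+2) -> c < m ->
  (forall c', (c' = p.*2.+1 \/ c' = p.*2.+2) -> c' < m -> (key (a c') <= key (a c))%R) ->
  (key (a p) < key (a c))%R ->
  heap_but lo m c (upd (upd a p (a c)) c (a p)).
Proof.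
move=> [h h'] lop cp cm cmax lt; split=> i e loi.
  move=> ic ei em; rewrite /upd (introF eqP ic).
  case: (eqVneq i p) => [ip|ip].
    case: (eqVneq e c) => [_|ec]; first exact: ltW.
    by rewrite ifN; [apply: cmax => //; lia | apply/eqP; lia].
  case: (eqVneq e c) => [|ec]; first lia.
  case: (eqVneq e p) => [ep|ep]; last by apply: (h i e) => //; exact/eqP.
  by subst e; apply: (h' i c).
move=> ci ce em; have -> : i = p by lia.
rewrite /upd eqxx; case: (eqVneq e c) => [|ec]; first lia.
case: (eqVneq e p) => [|ep]; first lia.
rewrite ifN; last by apply/eqP; lia.
by apply: (h c e) => //; lia.
Qed.

Lemma heap_root m a i : heap_from 0 m a -> i < m -> (key (a i) <= key (a 0))%R.
Proof.
move=> h; elim/ltn_ind: i => -[|i] IH im //.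
have lt : i./2 < i.+1 by lia.
have im2 : i./2 < m by lia.
apply: le_trans (IH _ lt im2); apply: (h (i./2)) => //.
by have := odd_double_half i; case: (odd i) => /=; lia.
Qed.

End Order.

(** [m <= p.+1 * 2 ^ e] bounds the depth left below p: a child c satisfies [2 * p.+1 <= c.+1], so
    each descent uses up one unit of e. *)
Lemma sift_spec A r s m p lo e a :
  nreg s 4 = 1 -> nreg s 10 = m -> nreg s 11 = p -> narr s A = a ->
  lo <= p -> m <= p.+1 * 2 ^ e ->
  heap_but (rarr s r) lo m p a ->
  run (sift A r) s (20 * e + 10)
   (fun s' => heap_from (rarr s r) lo m (narr s' A) /\ permuted_below m a (narr s' A)).
Proof.
set key := rarr s r.
move=> s4 s10 s11 sA lop mpe hb.
rewrite addnC; do 2!apply: run_cons.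
(* The last alternative is a break: register 12 is set to m in order to leave the loop. *)
pose I u (s' : state R) := [/\ nreg s' 4 = 1, nreg s' 10 = m, rarr s' r = key,
  permuted_below m a (narr s' A) &
  (exists p' e', [/\ lo <= p', m <= p'.+1 * 2 ^ e', nreg s' 11 = p',
     nreg s' 12 = p'.*2.+1 & heap_but key lo m p' (narr s' A) /\ u = 20 * e' + 1])
  \/ [/\ nreg s' 12 = m, heap_from key lo m (narr s' A) & 0 < u]].
apply: (@run_mono _ _ _ _ _ _ _ (@run_while _ _ _ I _ (20 * e + 1) _ _ _)) => //.
- split=> //=; rewrite ?sA; first exact: permuted_refl.
  by left; exists p, e; rewrite /upd /= s11 s4; split=> //; rewrite ?lop; lia.
- by move=> u s' [_ _ _ _ [[p' [e' [_ _ _ _ [_ ->]]]]|[_ _]]] //; lia.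
- move=> u s' [s'4 s'10 s'r pb [|[s'12 _ _]]]; last by rewrite /= s'12 s'10 ltnn.
  move=> [p' [e' [lop' mp s'11 s'12 [hb' ->]]]] /=; rewrite s'12 s'10 => cm; have p'm : p' < m by lia.
  exists 18.
  do 3!apply: run_cons.
  apply: (@run_mid _ _ _ _ 7 8 _ (fun s1 => exists c, [/\ c = p'.*2.+1 \/ c = p'.*2.+2,
    c < m, nreg s1 12 = c, nreg s1 13 = narr s' A c & rreg s1 2 = key (narr s' A c) /\
    forall c', (c' = p'.*2.+1 \/ c' = p'.*2.+2) -> c' < m ->
      (key (narr s' A c') <= key (narr s' A c))%R])) => //.
    apply: run_if => /=; rewrite s'12 s'10 s'4 addn1 s'r => c2m; last first.
      apply: run_skip => //=; exists p'.*2.+1; split=> //; [by left| by split=> // c' [->|->]; rewrite ?lexx //; lia].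
    do 2!apply: run_cons; apply: run_if => /=; rewrite s'r => lt.
      do 2!apply: run_cons; apply: run_instr => //=; exists p'.*2.+2; split=> //; first by right.
      by split=> // c' [->|->] _; [exact: ltW | exact: lexx].
    apply: run_skip => //=; exists p'.*2.+1; split=> //; first by left.
    by split=> // c' [->|->] _; rewrite ?lexx // leNgt lt.
  move=> s1 [c [cp cm' s1c s1ac [s1k cmax]]] [f1 f2 f3 f4].
  have {f1 f2 f3 f4} [g4 g10 g11 gA gr] : [/\ nreg s1 4 = 1, nreg s1 10 = m, nreg s1 11 = p',
      narr s1 A = narr s' A & rarr s1 r = key].
    by rewrite (f1 4 isT) (f1 10 isT) (f1 11 isT) (f3 A isT) (f4 r isT).
  do 2!apply: run_cons; apply: run_if => /=; rewrite g11 gA gr s1k => lt.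
    do 4!apply: run_cons; apply: run_instr => //.
    case: e' mp => [|e'] mp; first by lia.
    exists (20 * e' + 1); last by lia.
    split=> //=; rewrite ?eqxx ?g11 ?s1c ?s1ac ?gA ?gr //.
      apply: (permuted_trans pb); exact: permuted_swap.
    left; exists c, e'; split=> //; first by lia.
    - by apply: leq_trans mp _; rewrite expnS mulnA leq_mul2r; apply/orP; right; lia.
    - by rewrite g4 addn1 addnn.
    - split=> //; exact: heap_but_step.
  apply: run_instr => //=; exists 1; last by case: e' mp => [|e']; lia.
  split=> //=; rewrite ?g10 ?gA //; right.
  split=> //; apply: (heap_but_stop hb') => c' c'p c'm; apply: le_trans (cmax _ c'p c'm) _.
  by rewrite leNgt lt.
- by lia.
- move=> s' [[u [_ s'10 _ pb]]] /= [[p' [e' [_ _ s'11 s'12 [hb' _]]]]|[_ h _]] lt; split=> //.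
  by apply: heap_but_leaf hb'; rewrite leqNgt -s'12 -s'10 lt.
Qed.

Definition heapsort (A r : nat) : cmd :=
  NCopy 10 0 ;; NCopy 15 0 ;;
  While (NLt 3 15) (NSub 15 15 4 ;; NCopy 11 15 ;; sift A r) ;;
  While (NLt 3 10)
    (NSub 10 10 4 ;; NLoad 13 A 3 ;; NLoad 14 A 10 ;; NStore A 3 14 ;;
     NStore A 10 13 ;; NCopy 11 3 ;; sift A r).

Lemma heapsort_spec A r s n e a (key := rarr s r) :
  nreg s 0 = n -> nreg s 3 = 0 -> nreg s 4 = 1 -> narr s A = a -> 0 < n -> n <= 2 ^ e ->
  run (heapsort A r) s (2 * (n * (20 * e + 20)) + 4)
   (fun s' => (forall i j, i <= j < n -> (key (narr s' A i) <= key (narr s' A j))%R) /\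
      permuted_below n a (narr s' A)).
Proof.
move=> s0 s3 s4 sA n0 ne; rewrite !addnS addn0; do 2!apply: run_cons.
pose I u (s' : state R) := exists i, [/\ nreg s' 3 = 0, nreg s' 4 = 1 /\ nreg s' 10 = n,
  rarr s' r = key, permuted_below n a (narr s' A) &
  [/\ nreg s' 15 = i, i <= n, heap_from key i n (narr s' A) & u = i * (20 * e + 20) + 1]].
pose J u (s' : state R) := exists m, [/\ nreg s' 3 = 0, nreg s' 4 = 1 /\ nreg s' 10 = m,
  rarr s' r = key, permuted_below n a (narr s' A) &
  [/\ m <= n, heap_from key 0 m (narr s' A),
    (forall i j, i < m -> m <= j < n -> (key (narr s' A i) <= key (narr s' A j))%R),
    (forall i j, m <= i <= j -> j < n -> (key (narr s' A i) <= key (narr s' A j))%R) &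
    u = m * (20 * e + 20) + 1]].
have le1 x : n <= x.+1 * 2 ^ e by apply: leq_trans ne _; rewrite leq_pmull.
apply: (@run_mid _ _ _ _ (n * (20 * e + 20) + 1) (n * (20 * e + 20) + 1) _
  (fun s' => exists u, I u s' /\ nreg s' 15 = 0)).
- apply: (run_mono (@run_while _ _ _ I _ (n * (20 * e + 20) + 1) _ _ _)) => //.
  + exists n; split=> //=; rewrite ?s3 ?s4 ?s0 ?sA //; first exact: permuted_refl.
    by split=> // i c ni ci; lia.
  + by move=> u s' [i [_ _ _ _ [_ _ _ ->]]]; lia.
  + move=> u s' [[|i] [s'3 [s'4 s'10] s'r pb [s'15 lein hf ->]]]; rewrite /= s'3 s'15 // => _.
    exists (20 * e + 10).+2; do 2!apply: run_cons.
    apply: (run_use (@sift_spec _ _ _ n i i e (narr s' A) _ _ _ _ _ _ _)) => //=.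
    * by rewrite s'15 s'4 subn1.
    * rewrite s'r; split=> [j c ij ji|j c ij]; last by lia.
      by move=> cj cn; apply: (hf j c) => //; lia.
    * move=> s2 [hf2 pb2] [f1 _ _ f4]; exists (i * (20 * e + 20) + 1); last by lia.
      exists i; split.
      - by rewrite (f1 3 isT).
      - by rewrite (f1 4 isT) (f1 10 isT).
      - by rewrite (f4 r isT).
      - exact: permuted_trans pb pb2.
      - by rewrite -s'r (f1 15 isT) /= s'15 s'4 subn1; split=> //; exact: ltnW.
  + move=> s' [[u Iu]] h; exists u; split=> //; move: Iu => [i [s'3 _ _ _ _]].
    by move: h => /=; rewrite s'3 lt0n => /negbFE /eqP.
- move=> s1 [u [[i [g3 [g4 g10] gr pb [g15 _ hf _]]] s15]] _.
  have {g15 s15} i0 : i = 0 by rewrite -g15.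
  subst i; apply: (run_mono (@run_while _ _ _ J _ (n * (20 * e + 20) + 1) _ _ _)) => //.
  + by exists n; split=> //; split=> // *; lia.
  + by move=> v s' [m [_ _ _ _ [_ _ _ _ ->]]]; lia.
  + move=> v s' [[|m] [s'3 [s'4 s'10] s'r pb' [lemn hf' le lo ->]]]; rewrite /= s'3 s'10 // => _.
    exists (20 * e + 10).+4.+2; do 6!apply: run_cons.
    set b := narr s' A in pb' hf' le lo *.
    (* The root, a maximum of the heap, has been exchanged with the last heap entry; [b1 m] now
       opens the sorted tail. *)
    pose b1 := upd (upd b 0 (b m)) m (b 0).
    have b1lt i : i < m -> exists2 i', i' < m.+1 & b1 i = b i'.
      move=> im; rewrite /b1 /upd (ltn_eqF im); case: (eqVneq i 0) => [_|i0]; first by exists m.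
      by exists i => //; exact: ltnW.
    have b1m : b1 m = b 0 by rewrite /b1 /upd eqxx.
    have b1gt j : m < j -> b1 j = b j.
      by move=> mj; rewrite /b1 /upd (gtn_eqF mj) ifN //; apply/eqP; lia.
    have b1E : (if 10 == 3 then b else b1) = b1 by [].
    apply: (run_use (@sift_spec _ _ _ m 0 0 e b1 _ _ _ _ _ _ _)) => //=.
    * by rewrite s'10 s'4 subn1.
    * by rewrite !eqxx /= s'3 s'10 s'4 subn1.
    * by rewrite mul1n; apply: leq_trans ne; exact: ltnW.
    * rewrite s'r; split=> [j c _ j0|j c _]; last by lia.
      move=> cj cm; have [jm c0] : j < m /\ 0 < c by lia.
      rewrite /b1 /upd !(@ltn_eqF _ m) // [c == 0]gtn_eqF // ifN; last exact/eqP.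
      by apply: (hf' j c) => //; exact: ltnW.
    * move=> s2 [hf2 pb2] [f1 _ _ f4]; exists (m * (20 * e + 20) + 1); last by lia.
      have [g [_ gm ge a2E]] := pb2.
      exists m; split.
      - by rewrite (f1 3 isT).
      - by rewrite (f1 4 isT) (f1 10 isT) /= s'10 s'4 subn1.
      - by rewrite (f4 r isT).
      - apply: (permuted_trans pb'); apply: (permuted_trans _ (permuted_le (ltnW lemn) pb2)).
        by apply: permuted_swap => //; lia.
      - split=> //; [exact: ltnW | by rewrite -s'r | |].
        * move=> i j im /andP[mj jn]; rewrite !a2E (ge j mj).
          have [i' i'm ->] := b1lt _ (gm _ im).
          move: mj; rewrite leq_eqVlt => /orP[/eqP<-|mj]; first by rewrite b1m; exact: heap_root hf' i'm.
          by rewrite b1gt //; apply: le => //; rewrite mj.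
        * move=> i j /andP[mi ij] jn; have mj := leq_trans mi ij; rewrite !a2E !ge //.
          move: ij; rewrite leq_eqVlt => /orP[/eqP-> //|ij].
          have mj' : m < j by lia.
          rewrite (b1gt j) //; move: mi; rewrite leq_eqVlt => /orP[/eqP<-|mi].
            by rewrite b1m; apply: le => //; rewrite mj'.
          by rewrite b1gt //; apply: lo; rewrite ?mi // ltnW.
  + move=> s' [[v [m [s'3 [_ s'10] _ pb' [_ _ _ lo _]]]]] /=; rewrite s'3 s'10 lt0n => /negbFE /eqP m0.
    by split=> // i j /andP[ij jn]; apply: lo; rewrite ?m0.
- lia.
Qed.

Definition index_sort (A r : nat) : cmd := For 15 0 (NStore A 15 15) ;; heapsort A r.

Lemma index_sort_wnarr A r x : x != A -> ~~ wnarr x (index_sort A r).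
Proof. by move=> /negPf xA; rewrite /= !xA. Qed.

Lemma sort_spec A r s n e (key := rarr s r) :
  nreg s 0 = n -> nreg s 3 = 0 -> nreg s 4 = 1 -> 0 < n -> n <= 2 ^ e ->
  run (index_sort A r) s (60 * (n * e.+1))
   (fun s' => [/\ forall i j, i <= j < n -> (key (narr s' A i) <= key (narr s' A j))%R,
      forall i, i < n -> narr s' A i < n & forall i j, i < n -> j < n -> narr s' A i = narr s' A j -> i = j]).
Proof.
move=> s0 s3 s4 n0 ne.
apply: (@run_mid _ _ _ _ (n * 3 + 2) (2 * (n * (20 * e + 20)) + 4) _
  (fun s' => forall i, i < n -> narr s' A i = i)).
- apply: (@run_for _ _ _ _ (fun k s' => forall i, i < k -> narr s' A i = i) (fun=> 1) _ n) => //.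
  + move=> k s' kn s'15 _ _ IH; apply: run_instr => //= i ik; rewrite eqxx.
    by rewrite s'15 /=; case: (eqVneq i k) => [->|ne'] //; apply: IH; lia.
  + by rewrite sum_const_time.
- move=> s1 id1 [f1 _ _ f4].
  apply: (run_use (@heapsort_spec _ _ _ n e (narr s1 A) _ _ _ _ _ _)) => //.
  + by rewrite (f1 0 isT).
  + by rewrite (f1 3 isT).
  + by rewrite (f1 4 isT).
  + move=> s2 [srt [g [gi gm ge aE]]] _; rewrite /key -(f4 r isT); split=> // i.
      by move=> im; rewrite aE id1; apply: gm.
    by move=> j im jm; rewrite !aE !id1; [exact: gi | exact: gm | exact: gm].
- lia.
Qed.

End Heapsort.

Local Notation KEY := 1%N (only parsing).
Local Notation TAB := 2%N (only parsing).
Local Notation NXT := 3%N (only parsing).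
Local Notation OFF := 4%N (only parsing).
Local Notation PTN := 5%N (only parsing).
Local Notation MATE := 6%N (only parsing).
Local Notation ATT := 7%N (only parsing).
Local Notation POW := 8%N (only parsing).
Local Notation GORD := 9%N (only parsing).
(* Indices of the points, sorted by their j-th coordinate. *)
Local Notation ORD j := (j.+4.+4.+2)%N (only parsing).

(** * Cells of a given width *)

Section Chains.
Local Open Scope nat_scope.
Variable R : realType.
Implicit Types (s : state R).

(* Sets register 6 to the head of the chain of the indices i < nreg m with
   KEY[i] = nreg 5, or to n if there is none.  TAB is too large to be
   initialised: an entry is trusted only if the index it holds has the right
   key. *)
Definition lookup (m : nat) : cmd :=
  NLoad 6 TAB 5 ;;
  If (NLt 6 m)
    (NLoad 8 KEY 6 ;; NSub 7 8 5 ;; NSub 8 5 8 ;; NAdd 7 7 8 ;;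
     If (NLt 3 7) (NCopy 6 0) Skip)
    (NCopy 6 0).

(** Nothing is asked of an empty cell, where the entry of the uninitialised [TAB] is arbitrary. *)
Definition chained (key tab nxt : nat -> nat) n k :=
  forall q, cell key q k != [::] -> linked nxt n (tab q) (cell key q k).

(** A stray entry does no harm: an index below k whose key is q shows that the cell is nonempty, and
    then [chained] makes the entry its head. Naturals have no equality test, so the program adds
    both truncated differences and compares the sum with 0. *)
Lemma lookup_spec m s n k q key nxt :
  nreg s 0 = n -> nreg s 3 = 0 -> nreg s m = k -> nreg s 5 = q -> m != 6 ->
  narr s KEY = key -> narr s NXT = nxt -> chained key (narr s TAB) nxt n k ->
  run (lookup m) s 10 (fun s' => linked nxt n (nreg s' 6) (cell key q k)).
Proof.
move=> s0 s3 sm s5 m6 sK sN ch; apply: run_cons; apply: run_if => /=;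
  rewrite s5 (negPf m6) sm => lt.
- do 4!apply: run_cons; apply: run_if => /=; rewrite s3 s5 sK => ne.
  + apply: run_instr => //=; rewrite s0; case E : (cell key q k) => [//|y l].
    have := ch q; rewrite E => /(_ isT) /= [ty _ _].
    have : y \in cell key q k by rewrite E mem_head.
    by rewrite cellE -ty => /andP[_ /eqP ky]; move: ne; rewrite ky; lia.
  + apply: run_skip => //=; apply: ch; apply/eqP => E.
    have : narr s TAB q \in cell key q k by rewrite cellE lt /=; apply/eqP; lia.
    by rewrite E.
- apply: run_instr => //=; rewrite s0; case E : (cell key q k) => [//|y l].
  have := ch q; rewrite E => /(_ isT) /= [ty _ _].
  have : y \in cell key q k by rewrite E mem_head.
  by rewrite cellE -ty lt.
Qed.

(** Passing the loop counter to [lookup] restricts trust to the indices already inserted; a later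
    index may have the right key by now, as [KEY] is filled in advance. *)
Definition insert : cmd :=
  For 9 0 (NLoad 5 KEY 9 ;; lookup 9 ;; NStore NXT 9 6 ;; NStore TAB 5 9).

Lemma insert_spec s n key :
  nreg s 0 = n -> nreg s 3 = 0 -> nreg s 4 = 1 -> narr s KEY = key ->
  run insert s (n * 15 + 2) (fun s' => chained key (narr s' TAB) (narr s' NXT) n n).
Proof.
move=> s0 s3 s4 sK.
apply: (@run_for _ _ _ _ (fun k s' => [/\ nreg s' 3 = 0, narr s' KEY = key &
   chained key (narr s' TAB) (narr s' NXT) n k]) (fun=> 13) _ n) => //.
- move=> k s' kn s'9 s'0 s'4 [s'3 s'K ch]; apply: run_cons.
  apply: (@run_mid _ _ _ _ 10 2 _ _ _ (@lookup_spec _ _ n k (key k) key (narr s' NXT) _ _ _ _ _ _ _ _)) => //=.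
    by rewrite s'K s'9.
  move=> s2 lk [f1 _ f3 _]; have g5 := f1 5 isT; have g9 := f1 9 isT.
  apply: run_cons; apply: run_instr => //=; split=> /=.
  + by rewrite (f1 3 isT).
  + by rewrite (f3 KEY isT).
  rewrite g5 g9 (f3 TAB isT) (f3 NXT isT) /= s'9 s'K => q /=.
  have kc p : k \notin cell key p k by rewrite cellE ltnn.
  case: (eqVneq (key k) q) => [<-|kq] ne /=; last first.
    by rewrite linked_upd //; exact: ch.
  by rewrite !eqxx; split=> //; rewrite linked_upd.
- by rewrite sum_const_time.
- by move=> s' [].
Qed.

End Chains.

Section Grid.
Local Open Scope nat_scope.
Variable (R : realType) (d : nat).

Local Notation K := (d.*2).
Local Notation M := (K.*2.+1).

(* The key of a point is written in base n, its digits being the numbers of its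
   cells, each raised by K; a neighbouring cell is reached by adding an offset
   with digits at most 2K and then subtracting the shift, whose digits are all K,
   so that no subtraction is truncated.  Register 17: n^j, 18: shift, 23: current
   digit times n^j; real register 4: width of the cells. *)
Definition coord (j : nat) : cmd :=
  NLit 21 (M ^ j) ;; NLit 22 (K.*2 * M ^ j) ;;
  For 9 22 (NLoad 5 OFF 9 ;; NAdd 5 5 17 ;; NAdd 6 9 21 ;; NStore OFF 6 5) ;;
  NLit 5 (K * M ^ j) ;; NLoad 23 OFF 5 ;; NAdd 18 18 23 ;;
  NLoad 5 (ORD j) 3 ;; RLoad 6 j 5 ;;
  For 9 0
    (NLoad 5 (ORD j) 9 ;; RLoad 7 j 5 ;; RAdd 8 6 4 ;;
     If (RLt 8 7) (NAdd 23 23 17 ;; RCopy 6 7) Skip ;;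
     NLoad 6 KEY 5 ;; NAdd 6 6 23 ;; NStore KEY 5 6) ;;
  NLit 5 0 ;; For 9 0 (NAdd 5 5 17) ;; NCopy 17 5.

Definition keys : cmd :=
  For 9 0 (NStore KEY 9 3) ;; NStore OFF 3 3 ;; NLit 17 1 ;; NLit 18 0 ;;
  unroll coord d.

Definition sqdist : cmd :=
  RZero 10 ;;
  unroll (fun j => RLoad 11 j 20 ;; RLoad 12 j 6 ;; RSub 11 11 12 ;;
                 RMul 11 11 11 ;; RAdd 10 10 11) d.

(** A tie replaces the current best: the search starts with the threshold as best value, and a point
    exactly at the threshold must be accepted. *)
Definition visit : cmd :=
  NSub 7 6 20 ;; NSub 8 20 6 ;; NAdd 7 7 8 ;;
  If (NLt 3 7) (sqdist ;; If (RLt 9 10) Skip (RCopy 9 10 ;; NCopy 24 6)) Skip.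

Definition search : cmd :=
  RCopy 9 5 ;; NCopy 24 0 ;; NLit 22 (M ^ d) ;;
  For 9 22
    (NLoad 5 KEY 20 ;; NLoad 6 OFF 9 ;; NAdd 5 5 6 ;; NSub 5 5 18 ;; lookup 0 ;;
     While (NLt 6 0) (visit ;; NLoad 6 NXT 6)) ;;
  If (NLt 24 0) Skip (NLit 19 1) ;; NStore PTN 20 24.

(** The chain contains the point itself, so its first two entries settle whether the point is alone
    in its cell. *)
Definition query : cmd :=
  NLoad 5 KEY 20 ;; lookup 0 ;; NSub 7 6 20 ;; NSub 8 20 6 ;; NAdd 7 7 8 ;;
  If (NLt 3 7) (NStore PTN 20 6)
    (NLoad 6 NXT 20 ;; If (NLt 6 0) (NStore PTN 20 6) search).

Definition grid : cmd :=
  keys ;; insert ;; RMul 5 4 0 ;; RMul 5 5 5 ;; NLit 19 0 ;; For 20 0 query.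


(** * Cutting a sorted axis greedily *)

Section Scan.
Variables (v : nat -> R) (w : R).
Hypothesis w0 : (0 <= w)%R.

(* Number and starting point of the cell of the i-th value. *)
Fixpoint scan (i : nat) : nat * R :=
  if i is i'.+1 then
    let: (c, st) := scan i' in
    if (st + w < v i'.+1)%R then (c.+1, v i'.+1) else (c, st)
  else (0, v 0).

Lemma scan_le i : (scan i).1 <= i.
Proof. by elim: i => //= i; case: (scan i) => c st /= ci; case: ifP => _ /=; lia. Qed.

Lemma scanS i : scan i.+1 = if ((scan i).2 + w < v i.+1)%R then ((scan i).1.+1, v i.+1) else scan i.
Proof. by rewrite /=; case: (scan i). Qed.

Lemma scan_mono k l : k <= l -> (scan k).1 <= (scan l).1.
Proof.
elim: l => [|l IH]; first by rewrite leqn0 => /eqP->.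
rewrite leq_eqVlt => /orP[/eqP-> //|]; rewrite ltnS => /IH h.
by rewrite scanS; case: ifP => //= _; rewrite ltnW.
Qed.

Variable (n : nat).
Hypothesis vmono : forall i j, i <= j < n -> (v i <= v j)%R.

Lemma scan_start i : i < n -> ((scan i).2 <= v i <= (scan i).2 + w)%R.
Proof.
elim: i => [|i IH] lt; first by rewrite /= lexx lerDl.
rewrite scanS; case: ifPn => [_|/=]; first by rewrite /= lexx lerDl.
rewrite -leNgt => ->; rewrite andbT.
have /andP[h _] := IH (ltnW lt); apply: le_trans h _; apply: vmono.
by rewrite leqnSn.
Qed.

Lemma scan_same i j : i <= j < n -> (scan i).1 = (scan j).1 -> scan i = scan j.
Proof.
elim: j => [|j IH]; first by rewrite leqn0 => /andP[/eqP->].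
move=> /andP[]; rewrite leq_eqVlt => /orP[/eqP-> //|]; rewrite ltnS => ij jn.
rewrite scanS; case: ifP => _ /= e; first by have := scan_mono ij; rewrite e ltnn.
by apply: IH e; rewrite ij ltnW.
Qed.

Lemma scan_width i j : i <= j < n -> (scan i).1 = (scan j).1 -> (v j <= v i + w)%R.
Proof.
move=> ij /(scan_same ij) e; case/andP: (ij) => lij jn.
have /andP[_ h] := scan_start jn.
have /andP[h' _] := scan_start (leq_ltn_trans lij jn).
by apply: le_trans h _; rewrite lerD2r -e.
Qed.

(** A cell opens only beyond the end of the previous one, so consecutive starts are more than w
    apart. The first start after the cell of [v i] is only known to exceed [v i], whence the
    predecessor. *)
Lemma scan_apart i j : i <= j < n -> (scan i).1 < (scan j).1 ->
  (v i + ((scan j).1 - (scan i).1).-1%:R * w < (scan j).2)%R.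
Proof.
elim: j => [|j IH]; first by rewrite leqn0 => /andP[/eqP->]; rewrite ltnn.
move=> /andP[]; rewrite leq_eqVlt => /orP[/eqP->|]; first by rewrite ltnn.
rewrite ltnS => ij jn; rewrite scanS; case: ifP => [lt|_]; last by apply: IH; rewrite ij ltnW.
move=> /= lt'; have ijn : i <= j < n by rewrite ij ltnW.
case: (ltnP (scan i).1 (scan j).1) => cmp.
  have := IH ijn cmp; have -> : ((scan j).1.+1 - (scan i).1).-1 = ((scan j).1 - (scan i).1).-1.+1 by lia.
  by rewrite -natr1; lra.
have e : (scan i).1 = (scan j).1 by lia.
rewrite e subSnn /= mul0r addr0; apply: le_lt_trans lt.
rewrite -(scan_same ijn e); have := scan_start (leq_ltn_trans ij (ltnW jn)).
by case/andP.
Qed.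

Lemma scan_close k i j : i <= j < n -> (v j <= v i + k%:R * w)%R -> (scan j).1 <= (scan i).1 + k.
Proof.
move=> ij le; rewrite leqNgt; apply/negP => lt.
have lt' : (scan i).1 < (scan j).1 by apply: leq_ltn_trans lt; exact: leq_addr.
have := scan_apart ij lt'; case/andP: ij => _ jn.
have /andP[h _] := scan_start jn => h'.
have : (k%:R * w <= ((scan j).1 - (scan i).1).-1%:R * w)%R.
  by apply: ler_wpM2r => //; rewrite ler_nat; lia.
by lra.
Qed.

End Scan.


(** * Combining the cell numbers of all axes into one key *)

Definition ready n (x : nat -> nat -> R) (s : state R) :=
  [/\ nreg s 0 = n, nreg s 3 = 0, nreg s 4 = 1, rreg s 0 = (K%:R)%R &
   forall j, j < d -> [/\ rarr s j = x j,
     forall i i', i <= i' < n -> (x j (narr s (ORD j) i) <= x j (narr s (ORD j) i'))%R,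
     forall i, i < n -> narr s (ORD j) i < n &
     forall i i', i < n -> i' < n -> narr s (ORD j) i = narr s (ORD j) i' -> i = i']].

Lemma ready_frame n x c s s' : frame c s s' -> ready n x s ->
  ~~ [|| wnreg 0 c, wnreg 3 c, wnreg 4 c | wrreg 0 c] ->
  (forall j, j < d -> ~~ wrarr j c && ~~ wnarr (ORD j) c) -> ready n x s'.
Proof.
move=> [f1 f2 f3 f4] [s0 s3 s4 r0 h] /norP[n0 /norP[n3 /norP[n4 m0]]] ha.
split; rewrite ?f1 ?f2 // => j jd; have /andP[h1 h2] := ha j jd.
by rewrite (f3 _ h2) (f4 _ h1); exact: h.
Qed.

(** Pigeonhole: a sorting array is a permutation, so every point can be addressed by its rank on an
    axis. *)
Lemma inj_onto n (o : nat -> nat) : (forall i, i < n -> o i < n) ->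
  (forall i i', i < n -> i' < n -> o i = o i' -> i = i') ->
  forall p, p < n -> exists2 i, i < n & o i = p.
Proof.
move=> lt inj p pn; pose f (i : 'I_n) := Ordinal (lt i (ltn_ord i)).
have fi : injective f by move=> i i' [] /inj e; apply/val_inj/e.
exists (val (invF fi (Ordinal pn))); first exact: ltn_ord.
by have := f_invF fi (Ordinal pn) => -[].
Qed.

(** Invariant after j axes. The window of length B makes the next digit recoverable from the key.
    The last two clauses say that equal keys imply closeness, and that closeness puts a point into a
    surrounding cell. Surrounding cells may hold distant points as well; those are rejected by their
    distance. *)
Definition keyed n (x : nat -> nat -> R) (w : R) (j B shift : nat) (key off : nat -> nat) :=
  [/\ B = n ^ j, off 0 = 0,
    forall p, p < n -> shift <= key p < shift + B,
    forall p q, p < n -> q < n -> key p = key q ->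
      forall j', j' < j -> (`|x j' p - x j' q| <= w)%R &
    forall p q, p < n -> q < n -> (forall j', j' < j -> (`|x j' p - x j' q| <= K%:R * w)%R) ->
      exists2 i, i < M ^ j & key q + shift = key p + off i].

Section CoordMath.
Variables (n : nat) (x : nat -> nat -> R) (w : R) (j : nat) (o : nat -> nat).
Hypothesis w0 : (0 <= w)%R.
Hypothesis mono : forall i i', i <= i' < n -> (x j (o i) <= x j (o i'))%R.
Hypothesis olt : forall i, i < n -> o i < n.
Hypothesis oinj : forall i i', i < n -> i' < n -> o i = o i' -> i = i'.
Let v i := x j (o i).

Lemma keyed_step B shift key off key' off' :
  keyed n x w j B shift key off ->
  (forall i, i < M ^ j.+1 -> off' i = off (i %% M ^ j) + (i %/ M ^ j) * B) ->
  (forall i, i < n -> key' (o i) = key (o i) + (K + (scan v w i).1) * B) ->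
  keyed n x w j.+1 (n * B) (shift + K * B) key' off'.
Proof.
move=> [BE off0 kb ks kc] offE keyE.
have P0 : 0 < M ^ j by rewrite expn_gt0.
have onto := inj_onto olt oinj.
have vm : forall i i', i <= i' < n -> (v i <= v i')%R by exact: mono.
split.
- by rewrite expnS BE.
- by rewrite offE ?expn_gt0 // mod0n div0n off0.
- move=> p /onto[i lti <-]; rewrite keyE //; have := kb _ (olt lti).
  have c : (scan v w i).1 < n by apply: leq_ltn_trans lti; exact: scan_le.
  by nia.
- move=> p q /onto[i lti <-] /onto[i' lti' <-]; rewrite !keyE // => e.
  (* Two old keys differ by less than B, so distinct digits, which contribute multiples of B, cannot
     be compensated. *)
  have [k1 k2] : key (o i) = key (o i') /\ (scan v w i).1 = (scan v w i').1.
    have := kb _ (olt lti); have := kb _ (olt lti'); move: e.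
    by case: (ltngtP (scan v w i).1 (scan v w i').1) => c; nia.
  move=> j'; rewrite ltnS leq_eqVlt => /orP[/eqP->|]; last exact: ks (olt lti) (olt lti') k1 j'.
  case: (leqP i i') => ii'.
    have lt : i <= i' < n by rewrite ii'.
    have := scan_width w0 vm lt k2; have := vm _ _ lt; rewrite /v => h1 h2.
    by rewrite distrC ger0_norm; lra.
  have lt : i' <= i < n by rewrite ltnW.
  have := scan_width w0 vm lt (esym k2); have := vm _ _ lt; rewrite /v => h1 h2.
  by rewrite ger0_norm; lra.
- move=> p q /onto[i lti <-] /onto[i' lti' <-] h.
  have [k kM kE] : exists2 k, k < M ^ j & key (o i') + shift = key (o i) + off k.
    by apply: kc; [exact: olt | exact: olt | move=> j' j'j; apply: h; exact: ltnW].
  have := h j (ltnSn j); rewrite -![x j (o _)]/(v _) ler_norml => /andP[h1 h2].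
  have [c1 c2] : (scan v w i).1 <= (scan v w i').1 + K /\ (scan v w i').1 <= (scan v w i).1 + K.
    case: (leqP i i') => ii'.
      have lt : i <= i' < n by rewrite ii'.
      split; last by apply: (scan_close w0 vm lt); lra.
      by apply: leq_trans (leq_addr _ _); exact: scan_mono.
    have lt : i' <= i < n by rewrite ltnW.
    split; first by apply: (scan_close w0 vm lt); lra.
    by apply: leq_trans (leq_addr _ _); apply: scan_mono; exact: ltnW.
  set c := (scan v w i).1 in c1 c2 *; set c' := (scan v w i').1 in c1 c2 *.
  (* The signed difference of the cell numbers, raised by K, is the new offset digit; it lies
     between 0 and 2K, hence below M. *)
  exists ((K + c' - c) * M ^ j + k).
    by rewrite expnS; have : K + c' - c < M; [lia | nia].
  rewrite offE; last by rewrite expnS; have : K + c' - c < M; [lia | nia].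
  rewrite modnMDl modn_small // divnMDl // divn_small // addn0 !keyE // -/c -/c'.
  by nia.
Qed.

End CoordMath.


Lemma coord_frame j s s' n x : frame (coord j) s s' -> ready n x s -> ready n x s'.
Proof. by move=> f r; apply: (ready_frame f r). Qed.

Lemma coord_spec s n x w j B shift key off :
  0 < n -> (0 <= w)%R -> j < d -> ready n x s -> rreg s 4 = w ->
  nreg s 17 = B -> nreg s 18 = shift -> narr s KEY = key -> narr s OFF = off ->
  keyed n x w j B shift key off ->
  run (coord j) s ((40 + 6 * M ^ d) * n)
   (fun s' => keyed n x w j.+1 (nreg s' 17) (nreg s' 18) (narr s' KEY) (narr s' OFF)).
Proof.
move=> n0 w0 jd rd s4w s17 s18 sK sO kd.
have [s0 s3 s4 _ /(_ _ jd) [sx mono olt oinj]] := rd.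
set o := narr s (ORD j) in mono olt oinj.
pose P := M ^ j; have P0 : 0 < P by rewrite expn_gt0.
have PM : K.*2 * P <= M ^ d.
  apply: (@leq_trans (M ^ j.+1)); first by rewrite expnS leq_mul2r; apply/orP; right; lia.
  by apply: leq_pexp2l.
pose v i := x j (o i).
apply: (@run_mono _ _ _ (6 * (K.*2 * P) + 15 * n + 19)); [|nia|by move=> s'; exact: id].
have -> : 6 * (K.*2 * P) + 15 * n + 19 = (6 * (K.*2 * P) + 15 * n + 17).+2 by lia.
do 2!apply: run_cons.
apply: (@run_mid _ _ _ _ (6 * (K.*2 * P) + 2) (15 * n + 15) _
  (fun s' => forall i, i < P + K.*2 * P -> narr s' OFF i = off (i %% P) + (i %/ P) * B)); last by lia.
- apply: (@run_for _ _ _ _ (fun k s' => [/\ nreg s' 17 = B, nreg s' 21 = P &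
    forall i, i < P + k -> narr s' OFF i = off (i %% P) + (i %/ P) * B]) (fun=> 4) _ (K.*2 * P)) => //=.
  + by split=> // i; rewrite addn0 => iP; rewrite modn_small // divn_small // sO addn0.
  + move=> k s' kP s'9 s'22 s'4 [s'17 s'21 IH]; do 3!apply: run_cons; apply: run_instr => //; split=> //= i.
    rewrite s'9 s'17 s'21 => ik; case: (eqVneq i (k + P)) => [->|ne]; last by apply: IH; lia.
    by rewrite IH ?modnDr ?divnDr ?divnn ?P0 //; lia.
  + by rewrite sum_const_time; lia.
  + by move=> s' [].
move=> s1 offE fr; have rd1 : ready n x s1 by apply: (ready_frame fr).
case: (fr) => f1 f2 f3 _.
have g17 : nreg s1 17 = B by rewrite (f1 17 isT).
have g18 : nreg s1 18 = shift by rewrite (f1 18 isT).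
have gK : narr s1 KEY = key by rewrite (f3 KEY isT).
have gw : rreg s1 4 = w by rewrite (f2 4 isT).
have go : narr s1 (ORD j) = o by rewrite (f3 (ORD j) isT).
have {f1 f2 f3 fr} [g0 g3 g4 _ /(_ _ jd) [gx _ _ _]] := rd1.
have -> : 15 * n + 15 = (15 * n + 10).+4.+1 by lia.
do 5!apply: run_cons.
(* Naturals cannot be multiplied: [K * B] is read off [OFF], at the index whose new digit is K and
   whose other digits are 0. *)
have cm : narr s1 OFF (K * P) = K * B.
  by rewrite offE ?modnMl ?mulnK //; [case: kd => _ -> | nia].
apply: (@run_mid _ _ _ _ (11 * n + 2) (4 * n + 8) _
  (fun s' => forall i, i < n -> narr s' KEY (o i) = key (o i) + (K + (scan v w i).1) * B)); last by lia.
  apply: (@run_for _ _ _ _ (fun k s' => [/\ narr s' (ORD j) = o, rarr s' j = x j /\ rreg s' 4 = w,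
     nreg s' 17 = B, nreg s' 23 = (K + (scan v w k.-1).1) * B /\ rreg s' 6 = (scan v w k.-1).2 &
     forall i, i < n -> narr s' KEY (o i) = if i < k then key (o i) + (K + (scan v w i).1) * B else key (o i)])
     (fun=> 9) _ n) => //=.
  + by rewrite go gx gw g17 g3 cm addn0 gK.
  + move=> k s' kn s'9 s'0 s'4 [s'o [s'x s'w] s'17 [s'23 s'6] IH].
    do 3!apply: run_cons.
    (* At k = 0 the predecessor is 0 itself: the registers start with the first value, and the test
       fails there because w is nonnegative. *)
    have stepE : scan v w k = if ((scan v w k.-1).2 + w < v k)%R
        then ((scan v w k.-1).1.+1, v k) else scan v w k.-1.
      by case: k {kn s'9 s'23 s'6 IH} => [|k]; [rewrite /= ifN // -leNgt lerDl | rewrite scanS].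
    apply: (@run_mid _ _ _ _ 3 3 _ (fun s2 => nreg s2 23 = (K + (scan v w k).1) * B /\ rreg s2 6 = (scan v w k).2)) => //.
      apply: run_if => /=; rewrite s'6 s'w s'x s'o s'9 -/(v k) => lt; rewrite stepE lt.
        by apply: run_cons; apply: run_instr => //=; rewrite s'23 s'17; split=> //; nia.
      exact: run_skip.
    move=> s2 [t23 t6] [f1 f2 f3 f4]; have := f1 5 isT => /= t5.
    do 2!apply: run_cons; apply: run_instr => //=; split=> //=.
    * by rewrite (f3 (ORD j) isT).
    * by rewrite (f4 j isT) (f2 4 isT).
    * by rewrite (f1 17 isT).
    * rewrite t5 t23 (f3 KEY isT) /= s'o s'9 => i lti.
      case: (eqVneq i k) => [->|ik]; first by rewrite eqxx ltnSn IH // ltnn.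
      rewrite ifN; last by apply: contra ik => /eqP e; apply/eqP; apply: oinj.
      by rewrite IH //; have -> : (i < k.+1) = (i < k) by move: ik; lia.
  + by rewrite sum_const_time; lia.
  + by move=> s' [_ _ _ _ h] i lti; rewrite h // lti.
move=> s2 keyE [f1 f2 f3 f4]; rewrite addnS; apply: run_cons.
apply: (@run_mid _ _ _ _ (3 * n + 2) 1 _ (fun s' => nreg s' 5 = n * B)); last by lia.
  apply: (@run_for _ _ _ _ (fun k s' => nreg s' 5 = k * B /\ nreg s' 17 = B) (fun=> 1) _ n) => //=.
  + by rewrite (f1 0 isT) /= g0.
  + by rewrite (f1 4 isT) /= g4.
  + by rewrite (f1 17 isT).
  + by move=> k s' _ _ _ _ [h1 h2]; apply: run_instr => //=; rewrite h1 h2 mulSn addnC.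
  + by rewrite sum_const_time; lia.
  + by move=> s' [].
move=> st3 t5 [h1 _ h3 _]; apply: run_instr => //=.
rewrite t5 (h1 18 isT) /= (f1 18 isT) /= g18 (h3 OFF isT) (h3 KEY isT) /= (f3 OFF isT) /= cm.
apply: (@keyed_step _ x w j o w0 mono olt oinj _ _ _ _ _ _ kd) => // i iM.
by rewrite offE // -mulSn -expnS.
Qed.

Lemma keys_spec s n x w :
  0 < n -> (0 <= w)%R -> ready n x s -> rreg s 4 = w ->
  run keys s ((10 + d * (40 + 6 * M ^ d)) * n)
   (fun s' => keyed n x w d (nreg s' 17) (nreg s' 18) (narr s' KEY) (narr s' OFF)).
Proof.
move=> n0 w0 rd s4w; have [s0 s3 s4 _ _] := rd.
apply: (@run_mid _ _ _ _ (3 * n + 2) ((d * ((40 + 6 * M ^ d) * n) + 1).+3) _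
  (fun s' => forall i, i < n -> narr s' KEY i = 0)); last by nia.
- apply: (@run_for _ _ _ _ (fun k s' => nreg s' 3 = 0 /\ forall i, i < k -> narr s' KEY i = 0) (fun=> 1) _ n) => //=.
  + move=> k s' _ s'9 _ _ [s'3 IH]; apply: run_instr => //=; split=> // i ik.
    by case: ifPn => // ne; apply: IH; lia.
  + by rewrite sum_const_time; lia.
  + by move=> s' [].
move=> s1 key0 fr; do 3!apply: run_cons; have rd1 : ready n x s1 by apply: (ready_frame fr).
have [_ g3 _ _ _] := rd1.
apply: (@run_unroll _ _ (fun j s' => [/\ ready n x s', rreg s' 4 = w &
   keyed n x w j (nreg s' 17) (nreg s' 18) (narr s' KEY) (narr s' OFF)]) d ((40 + 6 * M ^ d) * n)) => //.
- split=> /=.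
  + by case: rd1 => *; split.
  + by case: fr => _ -> .
  + rewrite g3; split=> //= [p pn|p q pn qn _]; first by rewrite key0.
    by exists 0; rewrite ?expn0 // !key0.
- move=> j s' jd [rd' s'w kd]; apply: (run_use (@coord_spec _ n x w j _ _ _ _ _ _ _ _ _ _ _ _ _ kd)) => //.
  move=> s2 kd2 fr2; split=> //; first exact: coord_frame fr2 rd'.
  by case: fr2 => _ ->.
- by move=> s' [].
Qed.


(** * The partner of a single point *)

Definition sqd (x : nat -> nat -> R) (p q : nat) : R := (\sum_(j < d) (x j p - x j q) ^+ 2)%R.

Section Query.
Variables (n : nat) (x : nat -> nat -> R) (key off tab nxt : nat -> nat).
Variables (shift : nat) (thr : R).
Hypothesis ch : chained key tab nxt n n.

Definition query_ready p s :=
  [/\ ready n x s, p < n /\ nreg s 20 = p, nreg s 18 = shift, rreg s 5 = thr &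
   [/\ narr s KEY = key, narr s OFF = off, narr s TAB = tab & narr s NXT = nxt]].

Lemma query_ready_frame p c s s' : frame c s s' -> query_ready p s ->
  ~~ [|| wnreg 0 c, wnreg 3 c, wnreg 4 c | wrreg 0 c] ->
  (forall j, j < d -> ~~ wrarr j c && ~~ wnarr (ORD j) c) ->
  ~~ [|| wnreg 20 c, wnreg 18 c | wrreg 5 c] ->
  ~~ [|| wnarr KEY c, wnarr OFF c, wnarr TAB c | wnarr NXT c] ->
  query_ready p s'.
Proof.
move=> fr [rd [pn s20] s18 r5 [a1 a2 a3 a4]] h1 h2 /norP[n20 /norP[n18 nr]]
  /norP[k1 /norP[k2 /norP[k3 k4]]].
have rd' := ready_frame fr rd h1 h2; case: fr => f1 f2 f3 _.
by split; rewrite ?f1 ?f2 ?f3.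
Qed.

Lemma query_ready_set p s i v : i \notin [:: 0; 3; 4; 18; 20] -> query_ready p s ->
  query_ready p (set_nreg s i v).
Proof.
rewrite !inE !negb_or => /andP[i0 /andP[i3 /andP[i4 /andP[i18 i20]]]].
case=> -[s0 s3 s4 r0 h] [pn s20] s18 r5 a.
by split=> //; [split=> //|split=> //|]; rewrite /= /upd eq_sym ?(negPf i0) ?(negPf i3) ?(negPf i4)
  ?(negPf i18) ?(negPf i20).
Qed.

Lemma sqdist_spec s p y : query_ready p s -> nreg s 6 = y ->
  run sqdist s (6 * d + 2) (fun s' => rreg s' 10 = sqd x p y).
Proof.
move=> [[_ _ _ _ h] [_ s20] _ _ _] s6; rewrite addn2; apply: run_cons.
apply: (@run_unroll _ _ (fun j s' => [/\ nreg s' 20 = p, nreg s' 6 = y,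
   (forall j, j < d -> rarr s' j = x j) &
   rreg s' 10 = (\sum_(i < j) (x i p - x i y) ^+ 2)%R]) d 6) => //.
- by split=> //; [move=> j /h[]|rewrite big_ord0].
- move=> j s' jd [t20 t6 tx t10]; do 4!apply: run_cons; apply: run_instr => //; split=> //=.
  by rewrite t10 tx // t20 t6 big_ord_recr /= -expr2.
- by rewrite mulnC addn1.
- by move=> s' [].
Qed.

(** The sentinel n in register 24 means that no point seen so far is within the threshold; register
    9 then still holds the threshold. *)
Definition best p (seen : nat -> Prop) s :=
  (nreg s 24 = n /\ rreg s 9 = thr \/
   [/\ nreg s 24 < n, nreg s 24 <> p, rreg s 9 = sqd x p (nreg s 24) & (rreg s 9 <= thr)%R]) /\
  forall q, q < n -> q <> p -> seen q ->
    (rreg s 9 <= sqd x p q)%R /\ (nreg s 24 = n -> (thr < sqd x p q)%R).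

Lemma best_ext p (S S' : nat -> Prop) s : (forall q, q < n -> S' q -> S q) -> best p S s -> best p S' s.
Proof. by move=> SS [b1 b2]; split=> // q qn qp /(SS _ qn); exact: b2. Qed.

Lemma visit_spec s p y seen : query_ready p s -> nreg s 6 = y -> y < n -> best p seen s ->
  run visit s (6 * d + 9) (best p (fun q => seen q \/ q = y)).
Proof.
move=> rd s6 yn [b1 b2]; have [[_ s3 _ _ _] [_ s20] _ r5 _] := rd.
have -> : 6 * d + 9 = (6 * d + 2 + 3).+4 by lia.
do 3!apply: run_cons; apply: run_if => /=; rewrite s3 s6 s20 => ne; last first.
  apply: run_skip => //; first by lia.
  by split=> //= q qn qp [|qy]; [exact: b2 | lia].
set s1 := set_nreg _ _ _; have rd1 : query_ready p s1 by do 3!apply: query_ready_set => //.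
apply: (@run_mid _ _ _ _ (6 * d + 2) 3 _ _ _ (sqdist_spec rd1 (y := y) _)) => //.
move=> s2 t10 fr.
have t9 : rreg s2 9 = rreg s 9.
  by case: fr => _ -> //; rewrite /= wrreg_unroll.
have [t24 t6] : nreg s2 24 = nreg s 24 /\ nreg s2 6 = y.
  by case: fr => f1 _ _ _; rewrite !f1 //= wnreg_unroll.
apply: run_if => /=; rewrite t9 t10 => lt.
- apply: run_skip => //; rewrite /best t24 t9; split=> // q qn qp [|->]; first exact: b2.
  split; first exact: ltW.
  by case: b1 => [[_ <-]|[h _ _ _]] // e; move: h; rewrite e ltnn.
- apply: run_cons; apply: run_instr => //; split=> /=; rewrite ?t6 ?t10.
  + right; split=> //; first by lia.
    have : (sqd x p y <= rreg s 9)%R by rewrite leNgt lt.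
    by case: b1 => [[_ <-]|[_ _ _ h]] // h'; exact: le_trans h.
  + move=> q qn qp [sq|->]; last by split=> //; lia.
    split; last by lia.
    by apply: le_trans (proj1 (b2 q qn qp sq)); rewrite leNgt lt.
Qed.

(** Membership in one of the surrounding cells; by the last clause of [keyed] this covers all points
    within the threshold. *)
Definition near p q := exists2 i, i < M ^ d & key q + shift = key p + off i.

(** Kept as a sum over the scanned cells, because a single search can take linear time and only the
    total over all lone points is well bounded. *)
Definition search_time p :=
  \sum_(i < M ^ d) (20 + (6 * d + 11) * size (cell key (key p + off i - shift) n)) + 10.

Definition nearest p f := [/\ f < n, f <> p, (sqd x p f <= thr)%R &
  forall q, q < n -> q <> p -> near p q -> (sqd x p f <= sqd x p q)%R].

Definition isolated p := forall q, q < n -> q <> p -> near p q -> (thr < sqd x p q)%R.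

(** The flag is only ever raised, so a final 0 vouches for all the points. *)
Definition answer (s : state R) p (s' : state R) f :=
  nreg s' 19 = nreg s 19 /\ nearest p f \/ nreg s' 19 = 1 /\ isolated p.

Lemma search_spec s p : query_ready p s -> shift <= key p ->
  run search s (search_time p)
   (fun s' => narr s' PTN = upd (narr s PTN) p (narr s' PTN p) /\
      answer s p s' (narr s' PTN p)).
Proof.
move=> rd sk; have [[s0 _ s4 _ _] _ _ s5 _] := rd.
have -> : search_time p = (\sum_(i < M ^ d) (18 + (6 * d + 11) * size (cell key (key p + off i - shift) n) + 2) + 2 + 5).+3.
  rewrite /search_time -!addnS -addnA; congr addn; apply: eq_bigr => i _.
  by rewrite addnAC.
do 3!apply: run_cons.
pose S k q := exists2 i, i < k & key q + shift = key p + off i.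
apply: (@run_mid _ _ _ _ _ 5 _ (fun s' => [/\ query_ready p s' & best p (near p) s'])); last exact: leqnn.
  apply: (@run_for _ _ _ _ (fun k s' => query_ready p s' /\ best p (S k) s')
    (fun i => 18 + (6 * d + 11) * size (cell key (key p + off i - shift) n)) _ (M ^ d)) => //=.
  + by rewrite wnreg_unroll.
  + by rewrite wnreg_unroll.
  + by rewrite wnreg_unroll.
  + split; first by rewrite /step; do 3!apply: query_ready_set => //; case: rd => -[] *; split.
    split; first by left; rewrite /= s0.
    by move=> q _ _ [].
  + move=> k s' kM s'9 s'22 s'4 [rd' b]; rewrite -[18 + _]/((14 + _).+4); do 4!apply: run_cons.
    have [[g0 g3 _ _ _] [pn g20] g18 _ [gK gO gT gN]] := rd'.
    set s2 := step _ _; set q0 := key p + off k - shift.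
    have rd2 : query_ready p s2 by rewrite /s2 /step; do 4!apply: query_ready_set => //.
    apply: (@run_mid _ _ _ _ 10 ((6 * d + 11) * size (cell key q0 n) + 4) _ _ _
      (@lookup_spec _ _ _ n n q0 key nxt _ _ _ _ _ _ _ _)); last by lia.
    - by [].
    - by [].
    - by [].
    - by rewrite /s2 /= gK gO g20 s'9 g18.
    - by [].
    - by [].
    - by [].
    - by rewrite /= gT.
    move=> s3 lk fr; have rd3 : query_ready p s3 by apply: (query_ready_frame fr rd2).
    have b3 : best p (S k) s3 by case: fr => f1 f2 _ _; rewrite /best (f1 24 isT) (f2 9 isT).
    have t9 : nreg s3 9 = k by case: fr => f1 _ _ _; rewrite (f1 9 isT).
    apply: (@run_list _ _ _ _ _ nxt n (fun l s' => query_ready p s' /\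
       best p (fun q => S k q \/ q \in cell key q0 n /\ q \notin l) s') (cell key q0 n) _ (6 * d + 9)) => //=.
    - by rewrite wnreg_unroll.
    - by rewrite wnreg_unroll.
    - by rewrite wnarr_unroll.
    - by case: rd3 => -[].
    - by case: rd3 => _ _ _ _ [].
    - split=> //; apply: best_ext b3 => q qn [//|[h1 h2]]; by rewrite h1 in h2.
    - move=> a l st t6 _ _ al [rd4 b4]; have an : a < n by move: al; rewrite cellE => /andP[].
      apply: (run_use (visit_spec rd4 t6 an b4)) => // s5' b5 fr5; split.
        apply: (query_ready_frame fr5 rd4) => //=; rewrite ?wnreg_unroll ?wrreg_unroll ?wnarr_unroll //.
        by move=> j _; rewrite wrarr_unroll ?wnarr_unroll.
      apply: best_ext b5 => q qn [|[h1 h2]]; first by left; left.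
      by case: (eqVneq q a) => [->|qa]; [right | left; right; rewrite inE (negPf qa)].
    - by rewrite mulnC; lia.
    move=> st [rd4 b4]; split=> //; apply: best_ext b4 => q qn [i]; rewrite ltnS leq_eqVlt => /orP[/eqP->|ik] e.
      by right; split=> //; rewrite cellE qn /=; apply/eqP; rewrite /q0; lia.
    by left; exists i.
move=> s1 [rd1 [b1 b2]] fr1.
have t19 : nreg s1 19 = nreg s 19 by case: fr1 => f1 _ _ _; rewrite f1 //= wnreg_unroll.
have tP : narr s1 PTN = narr s PTN by case: fr1 => _ _ f3 _; rewrite f3 //= wnarr_unroll.
have [[g0 g3 _ _ _] [pn g20] g18 _ _] := rd1.
apply: (@run_mid _ _ _ _ 2 1 _ (fun s2 => (nreg s1 24 < n /\ nreg s2 19 = nreg s 19) \/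
    (nreg s1 24 = n /\ nreg s2 19 = 1))) => //.
  apply: run_if => /=; rewrite g0 => lt; first by apply: run_skip => //; left.
  by apply: run_instr => //=; right; split=> //; case: b1 => [[]|[]] //; rewrite lt.
move=> s2 h [f1 _ f3 _]; apply: run_instr => //=.
rewrite (f1 20 isT) (f1 24 isT) (f3 PTN isT) g20 tP eqxx; split=> //.
case: h => -[h1 h2]; [left|right].
  split=> //; case: b1 => [[e _]|[_ h3 h4 h5]]; first by move: h1; rewrite e ltnn.
  split=> //; first by rewrite -h4.
  by move=> q qn qp nr; rewrite -h4; case: (b2 q qn qp nr).
by split=> // q qn qp nr; case: (b2 q qn qp nr) => _; exact.
Qed.

Definition query_time p := 18 + (if cell key (key p) n == [:: p] then search_time p else 0).

Lemma query_spec s p : query_ready p s -> shift <= key p ->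
  run query s (query_time p)
   (fun s' => narr s' PTN = upd (narr s PTN) p (narr s' PTN p) /\
      (nreg s' 19 = nreg s 19 /\ [/\ narr s' PTN p < n, narr s' PTN p <> p & key (narr s' PTN p) = key p]
       \/ (forall q, q < n -> key q = key p -> q = p) /\ answer s p s' (narr s' PTN p))).
Proof.
move=> rd sk; have [[s0 s3 _ _ _] [pn s20] s18 s5 [sK sO sT sN]] := rd.
rewrite /query_time [18 + _]addSn; apply: run_cons.
set s1 := step _ _; have rd1 : query_ready p s1 by rewrite /s1 /step; apply: query_ready_set.
apply: (@run_mid _ _ _ _ 10 (7 + (if cell key (key p) n == [:: p] then search_time p else 0)) _ _ _
      (@lookup_spec _ _ _ n n (key p) key nxt _ _ _ _ _ _ _ _)) => //=.
- by rewrite sK s20.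
- by rewrite sT.
move=> s2 lk fr; have rd2 : query_ready p s2 by apply: (query_ready_frame fr rd1).
have [t19 tP] : nreg s2 19 = nreg s 19 /\ narr s2 PTN = narr s PTN.
  by case: fr => f1 _ f3 _; rewrite (f1 19 isT) (f3 PTN isT).
have [[g0 g3 _ _ _] [_ g20] _ _ [_ _ _ gN]] := rd2.
have pc : p \in cell key (key p) n by rewrite cellE pn eqxx.
have cu := cell_uniq key (key p) n.
have inc q : q \in cell key (key p) n -> q < n /\ key q = key p by rewrite cellE => /andP[-> /eqP].
case E : (cell key (key p) n) pc lk cu => [//|a l] pc /= [t6 an lk] /andP[al cu].
do 3!apply: run_cons; apply: run_if => /=; rewrite g3 t6 g20 => ne.
  apply: run_instr => //=; rewrite t6 g20 tP eqxx; split=> //; left; split=> //.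
  by split=> //; [lia | case: (inc a) => //; rewrite E mem_head].
have ap : a = p by lia.
rewrite {}ap in t6 an lk al E *; apply: run_cons; apply: run_if => /=; rewrite g0 g20 gN => lt.
  apply: run_instr => //=; rewrite ?g20 ?gN ?tP ?eqxx; split=> //; left; split=> //.
  case: l E pc al cu lk => [|b l] E pc al cu /= lk; first by move: lt; rewrite lk ltnn.
  case: lk => -> bn _; split=> //; first by move=> e; move: al; rewrite e mem_head.
  by case: (inc b) => //; rewrite E !inE eqxx orbT.
have l0 : l = [::] by case: l lk {E pc al cu} => [//|b l] /= [e bn _]; move: lt; rewrite e bn.
subst l; rewrite eqxx.
apply: (run_use (@search_spec _ p _ sk)); last first.
- move=> st /= [h1 h2] _; split; first by rewrite -tP.
  right; split; last by move: h2; rewrite /answer /= t19.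
  by move=> q qn qk; have : q \in cell key (key p) n by [rewrite cellE qn qk eqxx]; rewrite E inE => /eqP.
- by lia.
- by rewrite /step; do 4!apply: query_ready_set => //.
Qed.

End Query.


(** * A whole round of queries: amortised time and correctness *)

Lemma size_cell key q n : size (cell key q n) = \sum_(y < n) (key y == q).
Proof.
elim: n => [|n IH] /=; first by rewrite big_ord0.
by rewrite big_ord_recr /= -IH; case: ifP => _ /=; rewrite ?addn1 ?addn0.
Qed.

(* At a given offset, a cell is scanned by at most one point. *)
Lemma scan_time n key off shift : (forall p, p < n -> shift <= key p) ->
  \sum_(p < n) (query_time n key off shift p + 2) <=
  (30 + M ^ d * (6 * d + 31)) * n.
Proof.
move=> sk; pose A (p : 'I_n) := cell key (key p) n == [:: val p].
(* Exchange the sums: each y is counted once for every lone point that scans its cell. These points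
   share one key, as [shift <= key p] keeps the subtraction exact, and lone points with equal keys
   coincide. *)
have one i : \sum_(p < n | A p) size (cell key (key p + off i - shift) n) <= n.
  under eq_bigr do rewrite size_cell.
  apply: (@leq_trans (\sum_(y < n) 1)); last by rewrite sum1_card card_ord.
  rewrite exchange_big /=; apply: leq_sum => y _.
  rewrite -big_mkcondr sum1_card; apply/card_le1_eqP => p q.
  rewrite !unfold_in => /andP[/eqP ap /eqP kp] /andP[/eqP aq /eqP kq].
  have : val p \in cell key (key q) n.
    rewrite cellE ltn_ord; apply/eqP; have := sk _ (ltn_ord p); have := sk _ (ltn_ord q).
    by move: kp kq => /=; lia.
  by rewrite aq inE => /eqP/val_inj.
have -> : \sum_(p < n) (query_time n key off shift p + 2) =
   \sum_(p < n) 20 + \sum_(p < n | A p) search_time n key off shift p.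
  rewrite [X in _ = _ + X]big_mkcond -big_split; apply: eq_bigr => p _.
  by rewrite /query_time addnAC.
rewrite sum_const_time big_split /=.
have h1 : \sum_(p < n | A p) 10 <= n * 10.
  by rewrite -sum_const_time [leqRHS](bigID A) /= leq_addr.
have h2 : \sum_(p < n | A p) \sum_(i < M ^ d) (20 + (6 * d + 11) * size (cell key (key p + off i - shift) n))
    <= M ^ d * ((6 * d + 31) * n).
  rewrite exchange_big /= -(sum_const_time (M ^ d)); apply: leq_sum => i _.
  rewrite big_split /= -big_distrr /=.
  have h3 : \sum_(p < n | A p) 20 <= n * 20 by rewrite -sum_const_time [leqRHS](bigID A) /= leq_addr.
  by apply: leq_trans (leq_add h3 (leq_mul (leqnn (6 * d + 11)) (one i))) _; nia.
apply: leq_trans (leq_add (leqnn (n * 20)) (leq_add h2 h1)) _; nia.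
Qed.

(** Two kinds of partners: a cellmate, perhaps not nearest but within dw, or a minimiser among all
    points within the threshold. The first is good enough once dw is at most the optimum, the second
    once the threshold reaches it. *)
Definition grid_answer n x (w : R) f (flag : nat) :=
  let thr := ((K%:R * w) ^+ 2)%R in
  (flag = 0 -> forall p, p < n -> [/\ f p < n, f p <> p, (sqd x p (f p) <= thr)%R &
     (sqd x p (f p) <= (d%:R * w) ^+ 2)%R \/
     forall q, q < n -> q <> p -> (sqd x p q <= thr)%R -> (sqd x p (f p) <= sqd x p q)%R]) /\
  (flag <> 0 -> exists2 p, p < n & forall q, q < n -> q <> p -> (thr < sqd x p q)%R).

Definition grid_time := 50 + d * (40 + 6 * M ^ d) + (30 + M ^ d * (6 * d + 31)) + 27.

Lemma sqd_le_all x p q t : (0 <= t)%R -> (forall j, j < d -> (`|x j p - x j q| <= t)%R) ->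
  (sqd x p q <= d%:R * t ^+ 2)%R.
Proof.
move=> t0 h; rewrite /sqd -[d in (d%:R)%R]card_ord -sumr_const big_distrl /=.
apply: ler_sum => j _; rewrite mul1r -[leLHS]real_normK ?num_real //.
by rewrite lerXn2r ?nnegrE //; apply: h.
Qed.

Lemma sqd_ge_coord x p q j : j < d -> ((x j p - x j q) ^+ 2 <= sqd x p q)%R.
Proof.
move=> jd; rewrite /sqd (bigD1 (Ordinal jd)) //= lerDl; apply: sumr_ge0 => i _.
exact: sqr_ge0.
Qed.

Lemma grid_spec s n x w : 0 < n -> 0 < d -> (0 <= w)%R -> ready n x s -> rreg s 4 = w ->
  run grid s (grid_time * n) (fun s' => grid_answer n x w (narr s' PTN) (nreg s' 19)).
Proof.
move=> n0 d0 w0 rd s4w.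
apply: (@run_mid _ _ _ _ ((10 + d * (40 + 6 * M ^ d)) * n)
   (15 * n + 2 + ((30 + M ^ d * (6 * d + 31)) * n + 2).+3) _ _ _ (keys_spec n0 w0 rd s4w)); last first.
  by rewrite /grid_time; nia.
move=> s1; set B := nreg s1 17; set shift := nreg s1 18; set key := narr s1 KEY.
set off := narr s1 OFF => -[_ _ kb ks kc] fr.
have rd1 : ready n x s1.
  apply: (ready_frame fr rd); rewrite /= ?wnreg_unroll ?wrreg_unroll //.
  by move=> j jd; rewrite wrarr_unroll ?wnarr_unroll.
have t4 : rreg s1 4 = w by case: fr => _ -> //; rewrite /= wrreg_unroll.
have [g0 g3 g4 gr0 _] := rd1.
apply: (@run_mid _ _ _ _ (n * 15 + 2) ((30 + M ^ d * (6 * d + 31)) * n + 2).+3 _ _ _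
   (@insert_spec _ s1 n key g0 g3 g4 _)) => //; last by nia.
move=> s2; set tab := narr s2 TAB; set nxt := narr s2 NXT => ch fr2.
have rd2 : ready n x s2 by apply: (ready_frame fr2 rd1).
do 3!apply: run_cons.
pose thr := ((w * K%:R) * (w * K%:R))%R.
have thrE : thr = ((K%:R * w) ^+ 2)%R by rewrite expr2 /thr [(w * _)%R]mulrC.
have sk p : p < n -> shift <= key p by move=> /kb/andP[].
have wn i : i \in [:: 0; 3; 4; 17; 18; 20] -> ~~ wnreg i query.
  by rewrite !inE => /or4P[||| /or3P[]] /eqP-> /=; rewrite ?wnreg_unroll.
have wa i : i \in [:: 0; 1; 2; 3; 4] -> ~~ wnarr i query.
  by rewrite !inE => /or4P[||| /orP[]] /eqP-> /=; rewrite ?wnarr_unroll.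
apply: (@run_for _ _ _ _ (fun k s' => [/\ ready n x s', nreg s' 18 = shift, rreg s' 5 = thr,
   [/\ narr s' KEY = key, narr s' OFF = off, narr s' TAB = tab & narr s' NXT = nxt] &
   (nreg s' 19 = 0 -> forall p, p < k ->
      [/\ narr s' PTN p < n, narr s' PTN p <> p & key (narr s' PTN p) = key p] \/
      nearest n x key off shift thr p (narr s' PTN p)) /\
   (nreg s' 19 <> 0 -> exists2 p, p < n & isolated n x key off shift thr p)])
   (query_time n key off shift) _ n) => //=.
- by case: rd2.
- by case: rd2.
- exact: (wn 20 isT).
- exact: (wn 0 isT).
- exact: (wn 4 isT).
- case: fr2 => f1 f2 f3 _; rewrite (f1 18 isT) (f2 0 isT) (f2 4 isT) (f3 KEY isT) (f3 OFF isT) t4 gr0.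
  by split=> //; case: rd2 => *; split.
- move=> k s' kn s'20 s'0 s'4 [rd' g18 g5 ga [h1 h2]].
  have qr : query_ready n x key off tab nxt shift thr k s' by split.
  apply: (run_use (query_spec ch qr (sk _ kn))) => // s3 [PE ans] fr3.
  have /= rd3 : query_ready n x key off tab nxt shift thr k s3.
    apply: (query_ready_frame fr3 qr).
    + by rewrite (negPf (wn 0 _)) // (negPf (wn 3 _)) // (negPf (wn 4 _)) //= wrreg_unroll.
    + by move=> j _; rewrite /= wrarr_unroll ?wnarr_unroll.
    + by rewrite (negPf (wn 20 _)) // (negPf (wn 18 _)) //= wrreg_unroll.
    + by rewrite (negPf (wa 1 _)) // (negPf (wa 4 _)) // (negPf (wa 2 _)) // (negPf (wa 3 _)).
  case: rd3 => rd3 _ t18 t5 ta; split=> //; split; last first.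
    move=> flag; case: ans => [[e _]|[_ [[e _]|[_ h]]]]; [by apply: h2; rewrite -e| |by exists k].
    by apply: h2; rewrite -e.
  move=> flag p; rewrite ltnS leq_eqVlt => /orP[/eqP->|pk].
    case: ans => [[_ h]|[_ [[_ h]|[e _]]]]; [by left|by right|by rewrite e in flag].
  have -> : narr s3 PTN p = narr s' PTN p by rewrite PE /upd (ltn_eqF pk).
  apply: h1 => //; case: ans => [[<- _]|[_ [[<- _]|[e _]]]] //; by rewrite e in flag.
- by rewrite leq_add2r; exact: scan_time.
- move=> s' [_ _ _ _ [h1 h2]]; rewrite /grid_answer -thrE.
  have nearI p q : p < n -> q < n -> (sqd x p q <= thr)%R -> near key off shift p q.
    move=> pn qn le; apply: kc => // j jd; have := le_trans (sqd_ge_coord x p q jd) le.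
    rewrite thrE -[leLHS]real_normK ?num_real // ler_pXn2r // nnegrE ?mulr_ge0 ?ler0n //.
  split=> [/h1{}h1 p pn|/h2[p pn h]]; last first.
    exists p => // q qn qp; rewrite ltNge; apply/negP => le.
    by have := h q qn qp (nearI _ _ pn qn le); rewrite ltNge le.
  case: (h1 p pn) => [[fn fp fk]|[fn fp ft fm]]; last first.
    by split=> //; right => q qn qp le; apply: fm => //; exact: nearI.
  (* Cellmates differ by at most w on each axis, so their squared distance is at most d w^2, and
     this is at most (dw)^2 as d is a natural number. *)
  have h : (sqd x p (narr s' PTN p) <= (d%:R * w) ^+ 2)%R.
    apply: le_trans (sqd_le_all w0 _) _; first by move=> j jd; apply: ks => //.
    rewrite exprMn ler_wpM2r ?sqr_ge0 // -natrX ler_nat; nia.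
  split=> //; last by left.
  apply: le_trans h _; rewrite thrE lerXn2r ?nnegrE ?mulr_ge0 ?ler0n //.
  by rewrite ler_wpM2r // ler_nat; lia.
Qed.

End Grid.

(** * Searching for the width *)

Section Phases.
Local Open Scope nat_scope.
Variable (R : realType) (d : nat).
Local Notation K := (d.*2).

(** The machine cannot halve a natural, so the powers of two, which the bisection takes in
    decreasing order, are tabulated on the way up. *)
Definition powers : cmd :=
  NLit 28 0 ;; NLit 5 1 ;;
  While (NLt 5 0) (NStore POW 28 5 ;; NAdd 5 5 5 ;; NAdd 28 28 4).

Definition setup : cmd :=
  NLit 3 0 ;; NLit 4 1 ;; ROne 2 ;; RZero 0 ;;
  unroll (fun=> RAdd 0 0 2 ;; RAdd 0 0 2) d ;; RAdd 1 0 0 ;;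
  unroll (fun j => index_sort (ORD j) j) d ;; powers.

(* Real array 3d: gaps between consecutive values of coordinate j; real
   register 13: lower bound for the width of the cells. *)
Definition gaps (j : nat) : cmd :=
  For 9 0
    (NLoad 5 (ORD j) 9 ;; RLoad 6 j 5 ;; NSub 6 9 4 ;; NLoad 6 (ORD j) 6 ;;
     RLoad 7 j 6 ;; RSub 6 6 7 ;; RStore (3 * d) 9 6).

(** Real register 1 holds 4d, so the threshold 2dw becomes half the gap. A gap up to the optimal
    distance, equality included, then passes the strict test. *)
Definition set_width (i : nat) : cmd :=
  NLoad 5 GORD i ;; RLoad 4 (3 * d) 5 ;; RDiv 4 4 1.

(** The index is built bit by bit from the highest power of two: a bit is kept when it stays below n
    and the width it yields is still too small. *)
Definition bisect : cmd :=
  NLit 25 0 ;; NCopy 26 28 ;;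
  While (NLt 3 26)
    (NSub 26 26 4 ;; NLoad 27 POW 26 ;; NAdd 27 25 27 ;;
     If (NLt 27 0)
       (set_width 27 ;; grid d ;; If (NLt 3 19) (NCopy 25 27) Skip)
       Skip).

Definition narrow (j : nat) : cmd :=
  gaps j ;; index_sort GORD (3 * d) ;; bisect ;;
  set_width 25 ;; If (RLt 13 4) (RCopy 13 4) Skip.

(** Doubling comes before the test, since real register 13 holds a width already known to be too
    small. *)
Definition refine : cmd :=
  RCopy 4 13 ;; NLit 19 1 ;; While (NLt 3 19) (RAdd 4 4 4 ;; grid d).

Definition pow_ready n e (s : state R) :=
  [/\ nreg s 28 <= e, n <= 2 ^ nreg s 28 & forall i, i < nreg s 28 -> narr s POW i = 2 ^ i].

Lemma powers_spec s n e : nreg s 0 = n -> nreg s 4 = 1 -> n <= 2 ^ e ->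
  run powers s (4 * e + 3) (pow_ready n e).
Proof.
move=> s0 s4 ne; rewrite !addnS; do 2!apply: run_cons; rewrite addn0.
pose I u (s' : state R) := [/\ nreg s' 0 = n, nreg s' 4 = 1, nreg s' 5 = 2 ^ nreg s' 28,
  forall i, i < nreg s' 28 -> narr s' POW i = 2 ^ i &
  nreg s' 28 <= e /\ u = (4 * (e - nreg s' 28)).+1].
apply: (run_mono (@run_while _ _ _ I _ (4 * e).+1 _ _ _)) => //.
- by split=> //=; rewrite subn0.
- by move=> u s' [_ _ _ _ [_ ->]].
- move=> u s' [t0 t4 t5 IH [le ->]] /=; rewrite t0 t5 => lt.
  have lt' : nreg s' 28 < e by rewrite -(@ltn_exp2l 2) //; exact: leq_trans ne.
  exists 3; do 2!apply: run_cons; apply: run_instr => //.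
  exists (4 * (e - (nreg s' 28).+1)).+1; last by lia.
  split=> //=; rewrite ?t4 ?t5 ?addn1 //.
  + by rewrite expnS mul2n addnn.
  + move=> i; rewrite ltnS => ilt; case: (eqVneq i (nreg s' 28)) => [->|ne'] //.
    by apply: IH; move: ilt ne'; lia.
- move=> s' [[u [t0 t4 t5 IH [le _]]]] /= h; split=> //.
  by move: h; rewrite t0 t5; lia.
Qed.

Definition distinct n (x : nat -> nat -> R) :=
  forall p q, p < n -> q < n -> p <> q -> (0 < sqd d x p q)%R.

Lemma setup_spec s n e : nreg s 0 = n -> 0 < n -> n <= 2 ^ e ->
  run setup s ((10 + 65 * d) * (n * e.+1))
    (fun s' => [/\ ready d n (rarr s) s', pow_ready n e s', rreg s' 1 = (K.*2%:R)%R &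
       forall a, rarr s' a = rarr s a]).
Proof.
move=> s0 n0 ne; apply: (@run_mono _ _ _ (d * 2 + 1 + (d * (60 * (n * e.+1)) + 1 + (4 * e + 3)).+1).+4);
  [|nia|by move=> s'; exact].
do 4!apply: run_cons.
apply: (@run_mid _ _ _ _ (d * 2 + 1) (d * (60 * (n * e.+1)) + 1 + (4 * e + 3)).+1 _
  (fun s' => rreg s' 0 = (K%:R)%R)) => //.
  apply: (@run_unroll _ _ (fun j s' => rreg s' 2 = 1%R /\ rreg s' 0 = (j.*2%:R)%R) d 2) => //.
    move=> j s' _ [t2 t0]; apply: run_cons; apply: run_instr => //; split=> //=.
    by rewrite t0 t2 doubleS -!natr1.
  by move=> s' [].
move=> s1 t0 fr; apply: run_cons.
apply: (@run_mid _ _ _ _ (d * (60 * (n * e.+1)) + 1) (4 * e + 3) _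
  (fun s' => [/\ ready d n (rarr s) s', rreg s' 1 = (K.*2%:R)%R & forall a, rarr s' a = rarr s a])) => //.
  apply: (@run_unroll _ _ (fun j s' => [/\ [/\ nreg s' 0 = n, nreg s' 3 = 0, nreg s' 4 = 1 & rreg s' 0 = (K%:R)%R],
    rreg s' 1 = (K.*2%:R)%R, forall a, rarr s' a = rarr s a & forall j', j' < j ->
     [/\ forall i i', i <= i' < n -> (rarr s j' (narr s' (ORD j') i) <= rarr s j' (narr s' (ORD j') i'))%R,
     forall i, i < n -> narr s' (ORD j') i < n &
     forall i i', i < n -> i' < n -> narr s' (ORD j') i = narr s' (ORD j') i' -> i = i']])
     d (60 * (n * e.+1))) => //.
  - case: fr => f1 f2 _ f4; split=> //=.
    + by rewrite !f1 //= wnreg_unroll.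
    + by rewrite t0 -natrD addnn.
    + by move=> a; rewrite f4 //= wrarr_unroll.
  - move=> j s' jd [[g0 g3 g4 gr] gr1 ga IH].
    apply: (run_use (@sort_spec _ _ _ _ n e g0 g3 g4 n0 ne)) => // s2; rewrite ga => srt [f1 f2 f3 f4].
    split=> //.
    + by rewrite (f1 0 isT) (f1 3 isT) (f1 4 isT) (f2 0 isT).
    + by rewrite (f2 1 isT).
    + by move=> a; rewrite (f4 a isT).
    + move=> j'; rewrite ltnS leq_eqVlt => /orP[/eqP-> //|jj].
      rewrite f3; first exact: IH.
      by apply: index_sort_wnarr; rewrite !eqSS ltn_eqF.
  - move=> s' [[g0 g3 g4 gr] gr1 ga IH]; split=> //; split=> // j jd.
    by case: (IH j jd) => *; split.
move=> s2 [rd t1 ta] _; have [g0 _ g4 _ _] := rd.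
apply: (run_use (powers_spec g0 g4 ne)) => // s3 pr fr3; split=> //.
- exact: (ready_frame fr3 rd).
- by case: fr3 => _ -> .
- by move=> a; case: fr3 => _ _ _ ->.
Qed.


(** [D] is the square of the largest nearest-neighbour distance: the second clause provides a point
    at which the bound of the first is attained. *)
Definition max_nn n (x : nat -> nat -> R) (D : R) :=
  (forall p, p < n -> exists q, [/\ q < n, q <> p & (sqd d x p q <= D)%R]) /\
  (exists2 p, p < n & forall q, q < n -> q <> p -> (D <= sqd d x p q)%R).

(** The test is exact although cellmates need not be nearest: they too are within the threshold, and
    any partner of the extremal point within the threshold forces [D] below it. *)
Lemma grid_decides n x w f flag D : max_nn n x D -> grid_answer d n x w f flag ->
  (0 < flag) = ((K%:R * w) ^+ 2 < D)%R.
Proof.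
move=> [D1 [p pn D2]] [h1 h2]; case: (posnP flag) => [e|f0].
  apply/esym/negbTE; rewrite -leNgt; have [fn fp ft _] := h1 e p pn.
  exact: le_trans (D2 _ fn fp) ft.
have [p' p'n h] : exists2 p, p < n & forall q, q < n -> q <> p -> ((K%:R * w) ^+ 2 < sqd d x p q)%R.
  by apply: h2; lia.
apply/esym; have [q [qn qp le]] := D1 p' p'n; exact: lt_le_trans (h q qn qp) le.
Qed.


Lemma grid_keeps (s s' : state R) : frame (grid d) s s' ->
  [/\ [/\ nreg s' 25 = nreg s 25, nreg s' 26 = nreg s 26, nreg s' 27 = nreg s 27 & nreg s' 28 = nreg s 28],
    [/\ rreg s' 1 = rreg s 1, rreg s' 4 = rreg s 4 & rreg s' 13 = rreg s 13],
    narr s' POW = narr s POW, narr s' GORD = narr s GORD & forall a, rarr s' a = rarr s a].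
Proof.
move=> [f1 f2 f3 f4]; split; [split | split | | | move=> a];
  by rewrite ?f1 ?f2 ?f3 ?f4 //= ?wnreg_unroll ?wrreg_unroll ?wnarr_unroll ?wrarr_unroll.
Qed.

Lemma ready_grid n x (s s' : state R) : frame (grid d) s s' -> ready d n x s -> ready d n x s'.
Proof.
move=> fr rd; apply: (ready_frame fr rd) => /=; rewrite ?wnreg_unroll ?wrreg_unroll //.
by move=> j jd; rewrite ?wrarr_unroll ?wnarr_unroll.
Qed.

Section Narrow.
Variables (n : nat) (x : nat -> nat -> R) (D : R) (e : nat).
Hypotheses (n0 : 0 < n) (d0 : 0 < d) (D0 : (0 < D)%R) (opt : max_nn n x D).

Lemma K0 : (0 < K%:R :> R)%R.
Proof. by rewrite ltr0n double_gt0. Qed.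

(** Truncated subtraction makes 0 its own predecessor, so the list contains a gap 0. It comes first
    after sorting and gives the bisection an index that is good from the start, as [D] is
    positive. *)
Lemma gaps_spec s j o : j < d -> ready d n x s -> narr s (ORD j) = o ->
  run (gaps j) s (9 * n + 2) (fun s' => forall i, i < n ->
    rarr s' (3 * d) i = (x j (o i) - x j (o i.-1))%R).
Proof.
move=> jd [s0 s3 s4 _ h] so; have [sx _ _ _] := h j jd.
have j3 : (j == 3 * d) = false by apply/eqP; lia.
apply: (@run_for _ _ _ _ (fun k s' => [/\ narr s' (ORD j) = o, rarr s' j = x j &
   forall i, i < k -> rarr s' (3 * d) i = (x j (o i) - x j (o i.-1))%R]) (fun=> 7) _ n) => //=.
- move=> k s' kn s'9 s'0 s'4 [to tx IH]; do 6!apply: run_cons; apply: run_instr => //; split=> //=.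
    by rewrite j3.
  move=> i; rewrite eqxx /= to tx s'9 s'4 subn1 ltnS => ik.
  by case: (eqVneq i k) => [->//|ne]; apply: IH; move: ik ne; lia.
- by rewrite sum_const_time; lia.
- by move=> s' [].
Qed.

Definition narrow_pre (s : state R) := [/\ ready d n x s, pow_ready n e s, rreg s 1 = (K.*2%:R)%R,
  (0 <= rreg s 13)%R & ((K%:R * rreg s 13) ^+ 2 < D)%R].

Lemma bisect_spec s G g : narrow_pre s -> rarr s (3 * d) = G -> narr s GORD = g ->
  (forall i, i < n -> g i < n) -> (forall i i', i <= i' < n -> (G (g i) <= G (g i'))%R) ->
  (forall i, i < n -> (0 <= G i)%R) -> G (g 0) = 0%R ->
  run bisect s (e * (grid_time d * n + 12) + 3) (fun s' => exists lo, [/\ nreg s' 25 = lo, lo < n,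
    ((G (g lo) / 2) ^+ 2 < D)%R & forall i, lo < i < n -> (D <= (G (g i) / 2) ^+ 2)%R]).
Proof.
move=> [rd pr s1 _ _] sG sg glt gmono G0 g00; rewrite !addnS addn0; do 2!apply: run_cons.
have [pe pL pE] := pr.
(* The remaining range starts at register 25, a good index, and has length 2 to the power of
   register 26; its end is bad or beyond the last gap. *)
pose I u (s' : state R) := [/\ ready d n x s', [/\ nreg s' 28 = nreg s 28, narr s' POW = narr s POW,
   rarr s' (3 * d) = G, narr s' GORD = g & rreg s' 1 = (K.*2%:R)%R], nreg s' 26 <= nreg s 28,
   u = (nreg s' 26 * (grid_time d * n + 12)).+1 &
   [/\ nreg s' 25 < n, ((G (g (nreg s' 25)) / 2) ^+ 2 < D)%R &
     nreg s' 25 + 2 ^ nreg s' 26 < n -> (D <= (G (g (nreg s' 25 + 2 ^ nreg s' 26)%N) / 2) ^+ 2)%R]].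
apply: (run_mono (@run_while _ _ _ I _ (nreg s 28 * (grid_time d * n + 12)).+1 _ _ _)) => //.
- split=> //=; split=> //; first by rewrite g00 mul0r expr0n.
  by rewrite add0n ltnNge pL.
- by move=> u s' [_ _ _ -> _].
- move=> u s' [rd' [t28 tP tG tg t1] t26 -> [lon good bad]] /=; have [g0 g3 g4 _ _] := rd'.
  rewrite g3 => k0; set k := nreg s' 26 in t26 k0 bad *; set lo := nreg s' 25 in lon good bad *.
  exists (grid_time d * n).+4.+4.+1.
  do 3!apply: run_cons.
  have k1 : k.-1 < nreg s 28 by lia.
  have mid_E : narr s' POW (k - 1) = 2 ^ k.-1 by rewrite tP subn1 pE.
  have kE : 2 ^ k = 2 ^ k.-1 + 2 ^ k.-1 by rewrite -{1}(prednK k0) expnS mul2n addnn.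
  have budget : (grid_time d * n).+4.+4.+1 + (k.-1 * (grid_time d * n + 12)).+1 < (k * (grid_time d * n + 12)).+1.
    by rewrite -{2}(prednK k0) mulSn; lia.
  apply: run_if => /=; rewrite g4 -/k -/lo mid_E g0 => lt; last first.
    apply: run_skip; first by lia.
    exists (k.-1 * (grid_time d * n + 12)).+1; last exact: budget.
    split=> //=; rewrite ?g4 -/k -/lo ?subn1 //; first by lia.
    by split=> //; rewrite lt.
  do 2!(apply: run_assoc; apply: run_cons); apply: run_cons.
  set s2 := step _ _; set m := lo + 2 ^ k.-1 in lt *.
  have t4 : rreg s2 4 = (G (g m) / K.*2%:R)%R by rewrite /= tg tG t1.
  have rd2 : ready d n x s2 by case: rd' => *; split.
  have w0 : (0 <= G (g m) / K.*2%:R)%R by rewrite divr_ge0 ?ler0n ?G0 ?glt.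
  apply: (@run_mid _ _ _ _ (grid_time d * n) 2 _ _ _ (grid_spec n0 d0 w0 rd2 t4)); last by lia.
  move=> s3 ans fr; have rd3 := ready_grid fr rd2.
  have [[u25 u26 u27 u28] [u1 _ _] uP ug ua] := grid_keeps fr.
  have [v0 v3 v4 _ _] := rd3.
  have dec := grid_decides opt ans.
  have wE : (K%:R * (G (g m) / K.*2%:R) = G (g m) / 2)%R.
    by rewrite -(muln2 K) natrM; field; rewrite gt_eqF // K0.
  rewrite wE in dec.
  apply: run_if => /=; rewrite v3 dec => test.
    apply: run_instr => //; exists (k.-1 * (grid_time d * n + 12)).+1; last by lia.
    split=> //=; rewrite ?u28 ?uP ?ua ?ug ?u1 ?u26 ?u27 /= ?g4 -/k -/lo ?mid_E -/m ?subn1 //; first by lia.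
    by split=> //; rewrite /m -addnA -kE.
  apply: run_skip => //; exists (k.-1 * (grid_time d * n + 12)).+1; last by lia.
  split=> //=; rewrite ?u28 ?uP ?ua ?ug ?u1 ?u26 ?u25 /= ?g4 -/k -/lo ?mid_E ?subn1 //.
  - by lia.
  - by split=> //; rewrite -/m leNgt test.
- by have := leq_mul pe (leqnn (grid_time d * n + 12)); lia.
- move=> s' [[u [rd' _ _ _ [lon good bad]]]] /=; have [_ g3 _ _ _] := rd'; rewrite g3 => k0.
  have {}k0 : nreg s' 26 = 0 by lia.
  exists (nreg s' 25); split=> // i /andP[loi lti].
  rewrite k0 expn0 addn1 in bad; apply: le_trans (bad (leq_ltn_trans loi lti)) _.
  have h : (G (g (nreg s' 25).+1) <= G (g i))%R by apply: gmono; rewrite loi.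
  have h0 := G0 _ (glt _ (leq_ltn_trans loi lti)).
  by rewrite ler_pXn2r ?nnegrE //; lra.
Qed.


Lemma bisect_keeps s s' : frame bisect s s' -> ready d n x s ->
  [/\ ready d n x s', nreg s' 28 = nreg s 28, rreg s' 1 = rreg s 1 /\ rreg s' 13 = rreg s 13,
    narr s' POW = narr s POW /\ narr s' GORD = narr s GORD & forall a, rarr s' a = rarr s a].
Proof.
move=> fr rd; split.
- apply: (ready_frame fr rd) => /=; rewrite ?wnreg_unroll ?wrreg_unroll //.
  by move=> j jd; rewrite ?wrarr_unroll ?wnarr_unroll.
- by case: fr => f _ _ _; rewrite f //= !wnreg_unroll.
- by case: fr => _ f _ _; split; rewrite f //= !wrreg_unroll.
- by case: fr => _ _ f _; split; rewrite f //= !wnarr_unroll.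
- by move=> a; case: fr => _ _ _ f; rewrite f //= !wrarr_unroll.
Qed.

Definition spread (wb : R) j := forall p q, p < n -> q < n ->
  ((x j p - x j q) ^+ 2 <= D)%R -> (`|x j p - x j q| <= n%:R * (K.*2%:R * wb))%R.

(* Every gap between the j-th coordinates of two points is at most their
   distance, so the bound on such gaps can be summed. *)
Lemma spread_gaps (j : nat) o wb : (0 <= wb)%R -> (forall i, i < n -> o i < n) ->
  (forall i i', i < n -> i' < n -> o i = o i' -> i = i') ->
  (forall i i', i <= i' < n -> (x j (o i) <= x j (o i'))%R) ->
  (forall i, i < n -> ((x j (o i) - x j (o i.-1)) ^+ 2 <= D)%R ->
     (x j (o i) - x j (o i.-1) <= K.*2%:R * wb)%R) -> spread wb j.
Proof.
move=> wb0 olt oinj mono h.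
have c0 : (0 <= K.*2%:R * wb)%R by rewrite mulr_ge0 ?ler0n.
have main a b : a <= b < n -> ((x j (o b) - x j (o a)) ^+ 2 <= D)%R ->
    (x j (o b) - x j (o a) <= n%:R * (K.*2%:R * wb))%R.
  move=> /andP[ab bn] le.
  suff sum c : a <= c <= b -> (x j (o c) - x j (o a) <= (c - a)%:R * (K.*2%:R * wb))%R.
    apply: le_trans (sum b _) _; first by rewrite ab leqnn.
    by apply: ler_wpM2r => //; rewrite ler_nat; lia.
  elim: c => [|c IH] /andP[ac cb]; first by rewrite (_ : a = 0) ?subnn ?subrr ?mul0r //; lia.
  move: ac; rewrite leq_eqVlt => /orP[/eqP->|]; first by rewrite subnn subrr mul0r.
  rewrite ltnS => ac.
  have h1 := IH (introT andP (conj ac (ltnW cb))).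
  have m1 : (x j (o a) <= x j (o c))%R by apply: mono; lia.
  have m2 : (x j (o c) <= x j (o c.+1))%R by apply: mono; lia.
  have m3 : (x j (o c.+1) <= x j (o b))%R by apply: mono; lia.
  have h2 : (x j (o c.+1) - x j (o c) <= K.*2%:R * wb)%R.
    apply: (h c.+1); first by lia.
    by apply: le_trans le; rewrite /= ler_pXn2r ?nnegrE ?subr_ge0 //; lra.
  by rewrite subSn // -natr1 mulrDl mul1r; lra.
move=> p q pn qn; have [i lti <-] := inj_onto olt oinj pn.
have [i' lti' <-] := inj_onto olt oinj qn.
wlog ii' : i i' lti lti' / i <= i' => [W|] le.
  case: (leqP i i') => c; first exact: W.
  by rewrite distrC; apply: W => //; [exact: ltnW | rewrite -opprB sqrrN].
have m : (x j (o i) <= x j (o i'))%R by apply: mono; rewrite ii'.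
rewrite ler0_norm ?subr_le0 // opprB; apply: main; first by rewrite ii'.
by rewrite -opprB sqrrN.
Qed.

Lemma narrow_spec s j : n <= 2 ^ e -> j < d -> narrow_pre s ->
  run (narrow j) s ((grid_time d + 90) * (n * e.+1))
    (fun s' => [/\ narrow_pre s', (rreg s 13 <= rreg s' 13)%R, spread (rreg s' 13) j &
       forall a, a <> 3 * d -> rarr s' a = rarr s a]).
Proof.
move=> ne jd np; have [rd pr s1 wb0 wbD] := np; have [_ _ _ _ /(_ j jd)] := rd.
set o := narr s (ORD j) => -[sx mono olt oinj].
apply: (@run_mono _ _ _ (9 * n + 2 + (60 * (n * e.+1) + (e * (grid_time d * n + 12) + 3 + 5)))); [|nia|by move=> s'; exact].
apply: (@run_mid _ _ _ _ (9 * n + 2) _ _ _ _ (gaps_spec jd rd (erefl o))); last exact: leqnn.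
move=> st1 GE fr; set G := rarr st1 (3 * d) in GE.
have rd1 : ready d n x st1.
  by apply: (ready_frame fr rd) => //= j' j'd; rewrite orbF andbT; apply/eqP; lia.
have [f1 f2 f3 f4] := fr; have [g0 g3 g4 _ _] := rd1.
apply: (@run_mid _ _ _ _ (60 * (n * e.+1)) _ _ _ _ (@sort_spec _ GORD (3 * d) st1 n e g0 g3 g4 n0 ne)); last exact: leqnn.
move=> s2; set g := narr s2 GORD; rewrite -/G => -[gmono glt ginj] fr2.
have rd2 : ready d n x s2 by apply: (ready_frame fr2 rd1).
have [h1 h2 h3 h4] := fr2.
have np2 : narrow_pre s2.
  split=> //; rewrite ?(h2 1 isT) ?(h2 13 isT) ?(f2 1 isT) ?(f2 13 isT) //.
  by case: pr => *; split; rewrite ?(h1 28 isT) ?(h3 POW isT) ?(f1 28 isT) ?(f3 POW isT).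
have GG : rarr s2 (3 * d) = G by rewrite (h4 (3 * d) isT).
have Gge i : i < n -> (0 <= G i)%R by move=> lti; rewrite GE // subr_ge0; apply: mono; rewrite leq_pred.
have gonto := inj_onto glt ginj.
have g00 : G (g 0) = 0%R.
  have [i lti gi] := gonto 0 n0; have : (G (g 0) <= G (g i))%R by apply: gmono.
  rewrite gi [G 0]GE // subrr => le; apply/eqP; rewrite eq_le le.
  exact: Gge (glt _ n0).
apply: (@run_mid _ _ _ _ (e * (grid_time d * n + 12) + 3) 5 _ _ _ (bisect_spec np2 GG (erefl g) glt gmono Gge g00)); last exact: leqnn.
move=> s3 [lo [t25 lon good bad]] fr3.
have [rd3 t28 [t1 t13] [tP tg] ta] := bisect_keeps fr3 rd2.
do 2!(apply: run_assoc; apply: run_cons); apply: run_cons.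
set s4 := step _ _.
have t4 : rreg s4 4 = (G (g lo) / K.*2%:R)%R.
  by rewrite /= tg -/g t25 ta GG t1 (h2 1 isT) (f2 1 isT) s1.
have t13' : rreg s4 13 = rreg s 13 by rewrite /= t13 (h2 13 isT) (f2 13 isT).
have K4 : (0 < K.*2%:R :> R)%R by rewrite ltr0n !double_gt0.
have wl0 : (0 <= G (g lo) / K.*2%:R)%R by rewrite divr_ge0 ?ler0n ?Gge ?glt.
have wlD : ((K%:R * (G (g lo) / K.*2%:R)) ^+ 2 < D)%R.
  have -> : (K%:R * (G (g lo) / K.*2%:R) = G (g lo) / 2)%R.
    by rewrite -(muln2 K) natrM; field; rewrite gt_eqF // K0.
  exact: good.
have rd4 : ready d n x s4 by [].
(* Both outcomes of the last test leave in register 13 the larger of the old bound and the new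
   width; [fin] covers them at once. *)
have fin wb s5 : ready d n x s5 -> nreg s5 28 = nreg s4 28 -> narr s5 POW = narr s4 POW ->
    rreg s5 1 = rreg s4 1 -> rarr s5 = rarr s4 ->
    rreg s5 13 = wb -> (rreg s 13 <= wb)%R -> (G (g lo) / K.*2%:R <= wb)%R ->
    ((K%:R * wb) ^+ 2 < D)%R ->
    [/\ narrow_pre s5, (rreg s 13 <= rreg s5 13)%R, spread (rreg s5 13) j &
       forall a, a <> 3 * d -> rarr s5 a = rarr s a].
  move=> rd5 u28 uP u1 ua u13 le1 le2 lt.
  have wb0' : (0 <= wb)%R by exact: le_trans wl0 le2.
  rewrite u13; split=> //.
  - split; rewrite ?u13 //; last by rewrite u1 /= t1 (h2 1 isT) (f2 1 isT).
    by case: pr => *; split; rewrite ?u28 ?uP /= ?t28 ?tP (h1 28 isT) ?(h3 POW isT) (f1 28 isT) ?(f3 POW isT).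
  - apply: (spread_gaps wb0' olt oinj mono) => i lti; rewrite -GE // => le.
    have [k kn gk] := gonto i lti; rewrite -gk in le *.
    have : (G (g k) <= G (g lo))%R.
      (* A gap whose square is at most [D] cannot come after [lo]: there [D] is at most a quarter of
         that square, against [D > 0]. *)
      case: (leqP k lo) => kl; first by apply: gmono; rewrite kl.
      have := bad k; rewrite kl kn => /(_ isT) le'.
      by exfalso; move: le'; apply/negP; rewrite -ltNge expr_div_n; nra.
    move=> h; apply: le_trans h _; rewrite -ler_pdivrMl // mulrC; exact: le2.
  - by move=> a ne'; rewrite ua /= ta (h4 a isT) f4 //= orbF; apply/eqP.
apply: run_if; rewrite /holds t4 t13' => lt.
  apply: run_instr => //; apply: (fin (G (g lo) / K.*2%:R)%R) => //; last exact: ltW.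
apply: run_skip => //; apply: (fin (rreg s 13)) => //.
by rewrite leNgt lt.
Qed.


(** The extremal point has a neighbour at squared distance at most [D]. On each axis the square of
    their difference is at most [D] as well, so [spread] applies to all axes. *)
Lemma spread_bound wb : (0 <= wb)%R -> (forall j, j < d -> spread wb j) ->
  (D <= d%:R * (n%:R * (K.*2%:R * wb)) ^+ 2)%R.
Proof.
move=> wb0 sp; have [D1 [p pn D2]] := opt; have [q [qn qp le]] := D1 p pn.
apply: le_trans (D2 q qn qp) _; apply: sqd_le_all; first by rewrite !mulr_ge0 ?ler0n.
by move=> j jd; apply: sp => //; exact: le_trans (sqd_ge_coord _ _ _ jd) le.
Qed.

Lemma refine_spec s : n <= 2 ^ e -> narrow_pre s -> (forall j, j < d -> spread (rreg s 13) j) ->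
  run refine s ((grid_time d + 5) * (K.+1 * (n * e.+1)))
    (fun s' => forall p, p < n -> [/\ narr s' PTN p < n, narr s' PTN p <> p &
       (sqd d x p (narr s' PTN p) <= D)%R]).
Proof.
move=> ne [rd _ _ wb0 wbD] sp; have DB := spread_bound wb0 sp.
set wb := rreg s 13 in wb0 wbD sp DB.
(* A zero width would never grow by doubling; [DB] excludes it because [D] is positive. *)
have {}wb0 : (0 < wb)%R.
  rewrite lt_neqAle wb0 andbT; apply/eqP => w0; move: DB.
  by rewrite -w0 !mulr0 expr0n mulr0 leNgt D0.
have d1 : (1 <= d%:R :> R)%R by rewrite ler1n.
have n1 : (1 <= n%:R :> R)%R by rewrite ler1n.
(* By [DB], a width that is too small forces 1 < d t^2 for t = 2n / 2^i, hence 2^i < 2dn: otherwise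
   d t <= 1 and so t <= 1. As n <= 2^e and K = 2d < 2^K, at most e + K doublings occur. *)
have step_lt i : ((K%:R * (wb * 2 ^+ i)) ^+ 2 < D)%R -> i < e + K.
  move=> lt; have {lt DB} := lt_le_trans lt DB.
  have -> : (d%:R * (n%:R * (K.*2%:R * wb)) ^+ 2 = (K%:R * (wb * 2 ^+ i)) ^+ 2 * (d%:R * (n%:R * 2 / 2 ^+ i) ^+ 2) :> R)%R.
    rewrite -(muln2 K) natrM; field; by rewrite expf_neq0.
  rewrite ltr_pMr; last by rewrite exprn_gt0 // !mulr_gt0 ?exprn_gt0 ?K0.
  rewrite -(@ltn_exp2l 2) // => lt.
  suff : (2 ^+ i < d%:R * (n%:R * 2) :> R)%R.
    rewrite -natrX -!natrM ltr_nat => h; apply: (leq_trans h).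
    rewrite expnD; apply: (@leq_trans (2 ^ e * K)); first by rewrite -muln2; nia.
    by rewrite leq_mul2l ltnW ?orbT // ltn_expl.
  have p0 : (0 < 2 ^+ i :> R)%R by rewrite exprn_gt0.
  rewrite ltNge; apply/negP => le; move: lt; apply/negP; rewrite -leNgt.
  set t := (n%:R * 2 / 2 ^+ i)%R.
  have t0 : (0 <= t)%R by rewrite /t divr_ge0 ?mulr_ge0 ?exprn_ge0 ?ler0n.
  have td : (d%:R * t <= 1)%R by rewrite /t mulrA ler_pdivrMr // mul1r.
  by rewrite expr2 mulrA; nra.
set u0 := (e + K) * (grid_time d * n + 4) + 1.
apply: (@run_mono _ _ _ u0.+2); [|by rewrite /u0; nia|by move=> s'; exact].
do 2!apply: run_cons.
pose I u (s' : state R) := ready d n x s' /\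
  ((exists i, [/\ rreg s' 4 = (wb * 2 ^+ i)%R, ((K%:R * (wb * 2 ^+ i)) ^+ 2 < D)%R, 0 < nreg s' 19 &
     u = (e + K - i) * (grid_time d * n + 4) + 1]) \/
   [/\ 0 < u, nreg s' 19 = 0 & forall p, p < n -> [/\ narr s' PTN p < n, narr s' PTN p <> p &
       (sqd d x p (narr s' PTN p) <= D)%R]]).
apply: (run_mono (@run_while _ _ _ I _ u0 _ _ _)) => //.
- split=> //; left; exists 0; split=> //=; rewrite ?expr0 ?mulr1 //.
  by rewrite subn0.
- by move=> u s' [_ [[i [_ _ _ ->]]|[]]] //; rewrite addn1.
- move=> u s' [rd' [[i [t4 lt _ ->]]|[_ e0 _]]] /=; have [_ g3 _ _ _] := rd'; rewrite g3 ?e0 // => _.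
  have iE := step_lt i lt.
  exists (grid_time d * n).+1; apply: run_cons.
  set s2 := step _ _; have rd2 : ready d n x s2 by [].
  have w2 : rreg s2 4 = (wb * 2 ^+ i.+1)%R by rewrite /= t4 exprS; ring.
  have w20 : (0 <= wb * 2 ^+ i.+1)%R by rewrite mulr_ge0 ?exprn_ge0 // ltW.
  apply: (run_use (grid_spec n0 d0 w20 rd2 w2)) => // s3 ans fr.
  have rd3 := ready_grid fr rd2; have dec := grid_decides opt ans.
  have [_ [_ u4 _] _ _ _] := grid_keeps fr.
  exists ((e + K - i.+1) * (grid_time d * n + 4) + 1); last first.
    by rewrite -(subnSK iE) mulSn; lia.
  split=> //; case: (posnP (nreg s3 19)) => [f0|f0]; last first.
    by left; exists i.+1; split=> //; [rewrite u4 | rewrite -dec].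
  right; split=> //; first by rewrite addn1.
  move=> p pn; have [ans1 _] := ans; have [fn fp ft alt] := ans1 f0 p pn; split=> //.
  (* A cellmate is within d times the new width, that is, 2d times the previous one, which was too
     small. In the other case the flag 0 says that [D] is within the threshold, so the minimiser is
     a nearest neighbour. *)
  case: alt => [le|near].
    apply: (le_trans le); have -> : (d%:R * (wb * 2 ^+ i.+1) = K%:R * (wb * 2 ^+ i) :> R)%R.
      by rewrite -muln2 natrM exprS; ring.
    exact: ltW.
  have [D1 _] := opt; have [q [qn qp le]] := D1 p pn.
  apply: (le_trans _ le); apply: near => //; apply: (le_trans le).
  by rewrite leNgt -dec f0.
- move=> s' [[u [rd' [[i [_ _ f0 _]]|[_ _ h]]]]] /=; have [_ g3 _ _ _] := rd'; rewrite g3 //.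
  by rewrite f0.
Qed.

End Narrow.

Definition partners : cmd := setup ;; RZero 13 ;; unroll narrow d ;; refine.

Definition partners_time := 90 + 65 * d + d * (grid_time d + 90) + (grid_time d + 5) * K.+1.

Lemma partners_spec s n e D : nreg s 0 = n -> 0 < n -> 0 < d -> n <= 2 ^ e -> (0 < D)%R ->
  max_nn n (rarr s) D ->
  run partners s (partners_time * (n * e.+1))
    (fun s' => [/\ nreg s' 0 = n, nreg s' 3 = 0, nreg s' 4 = 1,
       forall a, a <> 3 * d -> rarr s' a = rarr s a &
       forall p, p < n -> [/\ narr s' PTN p < n, narr s' PTN p <> p &
         (sqd d (rarr s) p (narr s' PTN p) <= D)%R]]).
Proof.
move=> s0 n0 d0 ne D0 opt; set x := rarr s in opt *.
apply: (@run_mid _ _ _ _ ((10 + 65 * d) * (n * e.+1)) (d * ((grid_time d + 90) * (n * e.+1)) + 1 +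
  (grid_time d + 5) * (K.+1 * (n * e.+1))).+1 _ _ _ (setup_spec s0 n0 ne)); last by rewrite /partners_time; nia.
move=> s1 [rd pr t1 ta] _; apply: run_cons.
apply: (@run_mid _ _ _ _ (d * ((grid_time d + 90) * (n * e.+1)) + 1) _ _
  (fun s' => [/\ narrow_pre n x D e s', forall j, j < d -> spread n x D (rreg s' 13) j &
     forall a, a <> 3 * d -> rarr s' a = rarr s a])); last exact: leqnn.
  apply: (@run_unroll _ _ (fun j s' => [/\ narrow_pre n x D e s',
     forall j', j' < j -> spread n x D (rreg s' 13) j' &
     forall a, a <> 3 * d -> rarr s' a = rarr s a]) d ((grid_time d + 90) * (n * e.+1))) => //.
    by split=> //=; split=> //=; rewrite mulr0 expr0n.
  move=> j s' jd [np sp ua]; apply: (run_use (narrow_spec n0 d0 D0 opt ne jd np)) => // s2 [np2 le sp2 ub] _.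
  split=> //; last by move=> a ad; rewrite ub // ua.
  move=> j'; rewrite ltnS leq_eqVlt => /orP[/eqP-> //|jj] p q pn qn h.
  apply: le_trans (sp _ jj p q pn qn h) _.
  by rewrite !ler_wpM2l ?ler0n.
move=> s2 [np sp ua] _; have [[g0 g3 g4 _ _] _ _ _ _] := np.
apply: (run_use (refine_spec n0 d0 D0 opt ne np sp)) => // s3 h [f1 _ _ f4].
split=> //.
- by rewrite f1 //= !wnreg_unroll.
- by rewrite f1 //= !wnreg_unroll.
- by rewrite f1 //= !wnreg_unroll.
- by move=> a ad; rewrite f4 ?ua //= !wrarr_unroll.
Qed.

End Phases.

(** * Stars *)

Section Stars.
Local Open Scope nat_scope.

(* A greedy matching along the partners.  A matched point has attachments if it
   is the partner of an unmatched point; if both ends of a matching edge have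
   attachments, the edge is dropped. *)
Definition stars : cmd :=
  For 9 0 (NStore MATE 9 0 ;; NStore ATT 9 3) ;;
  For 9 0
    (NLoad 5 PTN 9 ;; NLoad 6 MATE 9 ;; NLoad 7 MATE 5 ;;
     If (NLt 6 0) Skip
       (If (NLt 7 0) Skip (NStore MATE 9 5 ;; NStore MATE 5 9))) ;;
  For 9 0
    (NLoad 6 MATE 9 ;;
     If (NLt 6 0) Skip (NLoad 5 PTN 9 ;; NStore ATT 5 4)) ;;
  For 9 0
    (NLoad 6 MATE 9 ;; NLoad 5 ATT 9 ;; NCopy 8 9 ;;
     If (NLt 6 0)
       (NLoad 7 ATT 6 ;;
        If (NLt 3 5) Skip
          (If (NLt 3 7) (NCopy 8 6) (If (NLt 6 9) (NCopy 8 6) Skip)))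
       (NLoad 8 PTN 9) ;;
     NStore KEY 9 8).

Variables (R : realType) (n : nat) (f : nat -> nat).
Implicit Types (s : state R).
Hypothesis flt : forall p, p < n -> f p < n.
Hypothesis fne : forall p, p < n -> f p <> p.

(** The value n marks an unmatched point. *)
Definition matching (m : nat -> nat) := forall p, p < n -> m p = n \/
  [/\ m p < n, m (m p) = p, m p <> p & m p = f p \/ f (m p) = p].

Definition attached (m a : nat -> nat) k := forall p, p < n ->
  (0 < a p <-> exists2 q, q < k & m q = n /\ f q = p).

(** If neither end of a matching edge has attachments, the smaller index is the centre. An unmatched
    point goes to its partner, which is matched by maximality and now has an attachment, so it is a
    centre. *)
Definition center (m a : nat -> nat) p :=
  if m p < n then
    if 0 < a p then p else if 0 < a (m p) then m p else if m p < p then m p else p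
  else f p.

(** A leaf and its centre are a partner pair in one direction or the other. The last clause excludes
    a centre without leaves, which would give an empty block in the walk. *)
Definition star_centers (c : nat -> nat) :=
  [/\ forall p, p < n -> c p < n, forall p, p < n -> c (c p) = c p,
    forall p, p < n -> c p <> p -> c p = f p \/ f (c p) = p &
    forall p, p < n -> c p = p -> exists2 q, q < n & q <> p /\ c q = p].

(** Dropping a matching edge is safe because each of its ends then keeps an attachment as a leaf.
    Idempotence rests on attached points being their own centres. *)
Lemma centers m a c : matching m -> (forall p, p < n -> m p < n \/ m (f p) < n) ->
  attached m a n -> (forall p, p < n -> c p = center m a p) -> star_centers c.
Proof.
move=> mm mx at_ ce.
have clt p : p < n -> center m a p < n.
  by move=> pn; rewrite /center; case: ifP => [mp|_]; [do !case: ifP | exact: flt].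
have unm p : p < n -> m p < n = false -> [/\ m p = n, m (f p) < n, 0 < a (f p) & center m a p = f p].
  move=> pn mp; have e : m p = n by case: (mm p pn) => [//|[h]]; rewrite h in mp.
  split=> //; [by case: (mx p pn) => //; rewrite mp | | by rewrite /center mp].
  by apply/(at_ _ (flt pn)); exists p.
have matched p : p < n -> m p < n -> [/\ m (m p) = p, m p <> p & m p = f p \/ f (m p) = p].
  by move=> pn mp; case: (mm p pn) => [e|[]//]; rewrite e ltnn in mp.
have fix_att p : p < n -> m p < n -> 0 < a p -> center m a p = p.
  by move=> pn mp ap; rewrite /center mp ap.
split=> p pn.
- by rewrite ce // clt.
- rewrite (ce p) // ce ?clt //; case: (boolP (m p < n)) => [mp|/negbTE mp]; last first.
    have [_ h1 h2 ->] := unm p pn mp; apply: fix_att => //; exact: flt.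
  have [mm1 mne _] := matched p pn mp.
  rewrite {2 3}/center mp; case: ifPn => [ap|nap]; first exact: fix_att.
  case: ifPn => [amp|namp]; first by apply: fix_att; rewrite ?mm1.
  case: ifPn => [lt|nlt]; rewrite /center ?mp ?mm1 ?pn (negbTE nap) (negbTE namp).
    by rewrite ltnNge ltnW.
  by rewrite (negbTE nlt).
- rewrite ce // /center; case: ifP => [mp|mp]; last by left.
  by have [_ _ h] := matched p pn mp; do !case: ifP => //.
- rewrite ce // => cp; case: (boolP (m p < n)) => [mp|/negbTE mp]; last first.
    by have [_ _ _] := unm p pn mp; rewrite cp => /esym /(fne pn).
  have [mm1 mne _] := matched p pn mp.
  case: (boolP (0 < a p)) => [ap|nap].
    have [q qn [mq fq]] := proj1 (at_ p pn) ap; exists q => //.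
    split; first by move=> e; apply: (fne qn); rewrite fq e.
    by rewrite ce // /center mq ltnn.
  exists (m p) => //; split=> //; rewrite ce //; move: cp.
  rewrite /center mp mm1 pn (negbTE nap); case: (0 < a (m p)) => //.
  by case: (ltngtP (m p) p) => //; lia.
Qed.

Lemma stars_spec s : nreg s 0 = n -> nreg s 3 = 0 -> nreg s 4 = 1 -> narr s PTN = f -> 0 < n ->
  run stars s (50 * n) (fun s' => star_centers (narr s' KEY)).
Proof.
move=> s0 s3 s4 sf n0.
apply: (@run_mid _ _ _ _ (4 * n + 2) (31 * n + 8) _ (fun s' => forall i, i < n -> narr s' MATE i = n /\ narr s' ATT i = 0)); last by lia.
  apply: (@run_for _ _ _ _ (fun k s' => nreg s' 3 = 0 /\ forall i, i < k -> narr s' MATE i = n /\ narr s' ATT i = 0) (fun=> 2) _ n) => //=.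
  - move=> k s' kn s'9 s'0 s'4 [s'3 IH]; apply: run_cons; apply: run_instr => //; split=> //= i.
    rewrite ltnS => ik; rewrite s'9 s'3 s'0; case: (eqVneq i k) => [_|ne] //=.
    by apply: IH; move: ik ne; lia.
  - by rewrite sum_const_time; lia.
  - by move=> s' [].
move=> s1 init [f1 _ f3 _].
have g0 : nreg s1 0 = n by rewrite (f1 0 isT).
have g4 : nreg s1 4 = 1 by rewrite (f1 4 isT).
have g3 : nreg s1 3 = 0 by rewrite (f1 3 isT).
have gf : narr s1 PTN = f by rewrite (f3 PTN isT).
clear f1 f3.
pose J k (m : nat -> nat) := matching m /\ forall p, p < k -> m p < n \/ m (f p) < n.
apply: (@run_mid _ _ _ _ (9 * n + 2) (22 * n + 6) _ (fun s' => J n (narr s' MATE))); last by lia.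
  apply: (@run_for _ _ _ _ (fun k s' => narr s' PTN = f /\ J k (narr s' MATE)) (fun=> 7) _ n) => //=.
  - by split=> //; split=> // p pn; left; case: (init p pn).
  - move=> k s' kn s'9 s'0 s'4 [s'f [mm mx]]; do 3!apply: run_cons.
    apply: run_if => /=; rewrite ?s'f ?s'9 ?s'0 => h1.
      apply: run_skip => //; split=> //; split=> // p; rewrite ltnS leq_eqVlt => /orP[/eqP->|]; [by left|exact: mx].
    apply: run_if => /=; rewrite ?s'f ?s'9 ?s'0 => h2.
      apply: run_skip => //; split=> //; split=> // p; rewrite ltnS leq_eqVlt => /orP[/eqP->|]; [by right|exact: mx].
    apply: run_cons; apply: run_instr => //=; rewrite ?s'f ?s'9 ?s'4; split=> //.
    set m := narr s' MATE in mm mx h1 h2 *.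
    pose m' := upd (upd m k (f k)) (f k) k.
    have fk := flt kn; have fkk := fne kn.
    have mk : m k = n by case: (mm k kn) => [//|[h]]; rewrite h in h1.
    have mfk : m (f k) = n by case: (mm _ fk) => [//|[h]]; rewrite h in h2.
    have m'k : m' k = f k by rewrite /m' /upd eqxx ifN //; apply/eqP => e; apply: fkk.
    have m'fk : m' (f k) = k by rewrite /m' /upd eqxx.
    have m'E p : p <> k -> p <> f k -> m' p = m p.
      by move=> /eqP/negPf h /eqP/negPf h'; rewrite /m' /upd h h'.
    split; rewrite -/m'.
      move=> p pn; case: (eqVneq p k) => [->|/eqP pk].
        by right; rewrite m'k m'fk; split=> //; left.
      case: (eqVneq p (f k)) => [->|/eqP pfk].
        by right; rewrite m'fk m'k; split=> //; [move=> e; exact: fkk | right].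
      rewrite m'E //; case: (mm p pn) => [|[h3 h4 h5 h6]]; [by left | right].
      split=> //; rewrite m'E //; move=> e; rewrite e in h4.
        by move: pn; rewrite -h4 mk ltnn.
      by move: pn; rewrite -h4 mfk ltnn.
    have grow p : p < n -> m p < n -> m' p < n.
      move=> pn mp; case: (eqVneq p k) => [->|/eqP pk]; first by rewrite m'k.
      by case: (eqVneq p (f k)) => [->|/eqP pfk]; rewrite ?m'fk ?m'E.
    move=> p; rewrite ltnS leq_eqVlt => /orP[/eqP->|pk]; first by left; rewrite m'k.
    have pn := ltn_trans pk kn.
    by case: (mx p pk) => h; [left | right]; apply: grow => //; exact: flt.
  - by rewrite sum_const_time; lia.
  - by move=> s' [].
move=> s2 [mm mx] [f1 _ f3 _].
have h0 : nreg s2 0 = n by rewrite (f1 0 isT).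
have h4 : nreg s2 4 = 1 by rewrite (f1 4 isT).
have h3 : nreg s2 3 = 0 by rewrite (f1 3 isT).
have hf : narr s2 PTN = f by rewrite (f3 PTN isT).
have ha : narr s2 ATT = narr s1 ATT by rewrite (f3 ATT isT).
clear f1 f3; set m := narr s2 MATE in mm mx.
apply: (@run_mid _ _ _ _ (6 * n + 2) (16 * n + 4) _ (fun s' => attached m (narr s' ATT) n)); last by lia.
  apply: (@run_for _ _ _ _ (fun k s' => [/\ narr s' PTN = f, narr s' MATE = m & attached m (narr s' ATT) k]) (fun=> 4) _ n) => //=.
  - split=> // p pn; rewrite ha; have [_ ->] := init p pn; split=> // -[q]; by rewrite ltn0.
  - move=> k s' kn s'9 s'0 s'4 [s'f s'm at_]; apply: run_cons.
    apply: run_if => /=; rewrite ?s'm ?s'9 ?s'0 => h1.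
      apply: run_skip => //; split=> //= p pn; rewrite at_ //; split=> -[q qk [mq fq]].
        by exists q => //; exact: ltnW.
      exists q => //; move: qk; rewrite ltnS leq_eqVlt => /orP[/eqP e|//].
      by move: h1; rewrite -e mq ltnn.
    have mk : m k = n by case: (mm k kn) => [//|[h]]; rewrite h in h1.
    apply: run_cons; apply: run_instr => //=; rewrite ?s'f ?s'9 ?s'4; split=> //= p pn.
    rewrite /=; case: (eqVneq p (f k)) => [->|pf]; first by split=> // _; exists k.
    rewrite at_ //; split=> -[q qk [mq fq]]; first by exists q => //; exact: ltnW.
    exists q => //; move: qk; rewrite ltnS leq_eqVlt => /orP[/eqP e|//].
    by move: pf; rewrite -fq e eqxx.
  - by rewrite sum_const_time; lia.
  - by move=> s' [].
move=> st3 at_ [f1 _ f3 _].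
have k0 : nreg st3 0 = n by rewrite (f1 0 isT).
have k4 : nreg st3 4 = 1 by rewrite (f1 4 isT).
have k3 : nreg st3 3 = 0 by rewrite (f1 3 isT).
have kf : narr st3 PTN = f by rewrite (f3 PTN isT).
have km : narr st3 MATE = m by rewrite (f3 MATE isT).
clear f1 f3; set a := narr st3 ATT in at_.
apply: (@run_for _ _ _ _ (fun k s' => [/\ nreg s' 3 = 0, narr s' PTN = f, narr s' MATE = m, narr s' ATT = a &
   forall p, p < k -> narr s' KEY p = center m a p]) (fun=> 10) _ n) => //=.
- move=> k s' kn s'9 s'0 s'4 [s'3 s'f s'm s'a IH]; do 3!apply: run_cons.
  apply: (@run_mid _ _ _ _ 6 1 _ (fun s2' => nreg s2' 8 = center m a k)) => //; last first.
    move=> s3' e [f1 _ f3 _]; apply: run_instr => //.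
    split=> /=; rewrite ?(f1 3 isT) ?(f3 PTN isT) ?(f3 MATE isT) ?(f3 ATT isT) //=.
    move=> p; rewrite ltnS (f1 9 isT) (f3 KEY isT) /= s'9 e => pk.
    by case: (eqVneq p k) => [->|ne] //; apply: IH; move: pk ne; lia.
  rewrite /center; apply: run_if => /=; rewrite ?s'm ?s'9 ?s'0 => h1; rewrite h1.
    apply: run_cons; apply: run_if => /=; rewrite ?s'3 ?s'a ?s'9 => h2; rewrite h2; first by apply: run_skip => //=; rewrite ?s'9.
    apply: run_if => /=; rewrite ?s'3 ?s'a ?s'm ?s'9 => h3'; rewrite h3'; first by apply: run_instr => //=; rewrite ?s'm ?s'9.
    by apply: run_if => /=; rewrite ?s'm ?s'9 => h4'; rewrite h4';
      [apply: run_instr => //=; rewrite ?s'm ?s'9 | apply: run_skip => //=; rewrite ?s'9].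
  by apply: run_instr => //=; rewrite ?s'f ?s'9.
- by rewrite sum_const_time; lia.
- by move=> s' [_ _ _ _ cE]; exact: centers mm mx at_ cE.
Qed.

End Stars.

(** * Writing the two curves to memory *)

Section Output.
Local Open Scope nat_scope.
Variables (R : realType) (d : nat).
Implicit Types (s : state R).

(** In the layout of [stores], register k is the length of list k, and thus the position at which
    its next point goes. *)
Definition emit (k i : nat) : cmd :=
  unroll (fun j => RLoad 11 j i ;; RStore (k * d + j) k 11) d ;; NAdd k k 4.

Definition emit_leaf : cmd :=
  NSub 7 6 20 ;; NSub 8 20 6 ;; NAdd 7 7 8 ;; If (NLt 3 7) (emit 2 6) Skip.

(** [KEY] now holds the centres and the chains have been rebuilt from it, so a star is a cell; its
    centre, also in the chain, is skipped by [emit_leaf]. *)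
Definition output : cmd :=
  NLit 1 0 ;; NLit 2 0 ;;
  For 20 0
    (NLoad 5 KEY 20 ;; NSub 7 5 20 ;; NSub 8 20 5 ;; NAdd 7 7 8 ;;
     If (NLt 3 7) Skip
       (emit 1 20 ;; NCopy 5 20 ;; lookup 0 ;;
        While (NLt 6 0) (emit_leaf ;; NLoad 6 NXT 6))).

Variable (x : nat -> nat -> R).

Definition listed s (k : nat) (l : seq nat) := nreg s k = size l /\
  forall i j, i < size l -> j < d -> rarr s (k * d + j) i = x j (nth 0 l i).

Definition listing s (l1 l2 : seq nat) :=
  [/\ forall j, j < d -> rarr s j = x j, listed s 1 l1 & listed s 2 l2].

Lemma emit_spec s k i l1 l2 p : k \in [:: 1; 2] -> i != k ->
  nreg s i = p -> nreg s 4 = 1 -> listing s l1 l2 ->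
  run (emit k i) s (2 * d + 2)
    (fun s' => listing s' (if k == 1 then rcons l1 p else l1) (if k == 1 then l2 else rcons l2 p)).
Proof.
move=> k12 ik si s4 [sx [n1 a1] [n2 a2]].
have k0 : 0 < k < 3 by move: k12; rewrite !inE => /orP[]/eqP->.
(* List and coordinate are recovered from the array number by division by d, so writing one column
   leaves the others intact. *)
have colE k' j k'' j' : j < d -> j' < d -> (k' * d + j == k'' * d + j') = (k' == k'') && (j == j').
  move=> jd jd'; apply/eqP/andP => [e|[/eqP-> /eqP->]] //.
  have d0 : 0 < d by exact: leq_ltn_trans jd.
  have e1 : k' = k'' by have := congr1 (divn^~ d) e; rewrite !divnMDl // !divn_small // !addn0.
  have e2 : j = j' by move: e; rewrite e1 => /addnI.
  by rewrite e1 e2 !eqxx.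
pose l k' := if k' == 1 then l1 else l2.
have nE k' : 0 < k' < 3 -> nreg s k' = size (l k').
  by rewrite /l; case: k' => [|[|[|]]].
have aE k' r j : 0 < k' < 3 -> r < size (l k') -> j < d -> rarr s (k' * d + j) r = x j (nth 0 (l k') r).
  by rewrite /l; case: k' => [|[|[|]]] //= _; [exact: a1 | exact: a2].
apply: (@run_mid _ _ _ _ (d * 2 + 1) 1 _ (fun s' => [/\ forall y, nreg s' y = nreg s y,
   forall j, j < d -> rarr s' j = x j & forall k' j r, 0 < k' < 3 -> j < d ->
   rarr s' (k' * d + j) r = if (k' == k) && (r == nreg s k) then x j p else rarr s (k' * d + j) r])); last by lia.
  apply: (@run_unroll _ _ (fun j0 s' => [/\ forall y, nreg s' y = nreg s y,
   forall j, j < d -> rarr s' j = x j & forall k' j r, 0 < k' < 3 -> j < d ->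
   rarr s' (k' * d + j) r = if [&& k' == k, r == nreg s k & j < j0] then x j p else rarr s (k' * d + j) r]) d 2) => //.
  - by split=> // k' j r _ _; rewrite ltn0 !andbF.
  - move=> j0 s' j0d [t1 t2 t3]; apply: run_cons; apply: run_instr => //; split=> //= [j jd|k' j r k'3 jd].
      by rewrite ifN ?t2 //; apply/eqP; nia.
    rewrite colE // ltnS leq_eqVlt; case: (eqVneq k' k) => [->|kk] /=; last by rewrite t3 // (negPf kk).
    rewrite !t1 (t2 j0 j0d) si; case: (eqVneq j j0) => [->|jj] /=.
      by rewrite andbT; case: eqP => // _; rewrite t3 // ltnn !andbF.
    by rewrite t3 // eqxx.
  - move=> s' [t1 t2 t3]; split=> // k' j r k'3 jd; by rewrite t3 // jd andbT.
move=> s1 [t1 t2 t3] _; apply: run_instr => //.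
have main k' : 0 < k' < 3 -> listed (step (NAdd k k 4) s1) k'
    (if k' == k then rcons (l k') p else l k').
  move=> k'3; split=> /=.
    rewrite !t1 s4 addn1; case: (eqVneq k' k) => [<-|_]; last by rewrite nE.
    by rewrite size_rcons nE.
  move=> r j rl jd; rewrite t3 //; case: (eqVneq k' k) rl => [<-|_] rl /=; last exact: aE.
  move: rl; rewrite size_rcons ltnS nth_rcons leq_eqVlt nE // => /orP[/eqP->|rl].
    by rewrite eqxx ltnn.
  by rewrite (ltn_eqF rl) rl aE.
split=> //.
- by have := main 1 isT; rewrite eq_sym.
- by have := main 2 isT; move: k12; rewrite !inE => /orP[]/eqP->.
Qed.

Definition leaves (c : nat -> nat) n p := [seq q <- cell c p n | q != p].

Definition centers_below (c : nat -> nat) k := [seq p <- iota 0 k | c p == p].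

Lemma centers_belowS c k :
  centers_below c k.+1 = if c k == k then rcons (centers_below c k) k else centers_below c k.
Proof.
rewrite /centers_below -addn1 iotaD filter_cat add0n /=.
by case: ifP; rewrite ?cats1 ?cats0.
Qed.

Lemma output_spec s n c : nreg s 0 = n -> nreg s 3 = 0 -> nreg s 4 = 1 -> narr s KEY = c ->
  0 < n -> chained c (narr s TAB) (narr s NXT) n n -> (forall j, j < d -> rarr s j = x j) ->
  run output s ((40 + 4 * d) * n)
    (fun s' => listing s' (centers_below c n) (flatten [seq leaves c n p | p <- centers_below c n])).
Proof.
move=> s0 s3 s4 sc n0 ch sx; set tab := narr s TAB in ch; set nxt := narr s NXT in ch.
pose tb k := 22 + 2 * d + (2 * d + 10) * size (cell c k n).
have total : \sum_(k < n) (tb k + 2) + 2 <= ((40 + 4 * d) * n).-2.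
  under eq_bigr do rewrite addnAC.
  rewrite big_split /= sum_const_time -big_distrr /=.
  (* Every point occurs in the chain of its own centre only. *)
  have le : \sum_(k < n) size (cell c k n) <= n.
    under eq_bigr do rewrite size_cell.
    rewrite exchange_big /=; apply: (@leq_trans (\sum_(y < n) 1)); last by rewrite sum1_card card_ord.
    apply: leq_sum => y _; rewrite -big_mkcond sum1_card; apply/card_le1_eqP => p q.
    by rewrite !unfold_in => /eqP e /eqP e'; apply/val_inj; rewrite /= -e -e'.
  move: le; move: (\sum_(k < n) _) => S le; have := leq_mul (leqnn (2 * d + 10)) le; lia.
have -> : (40 + 4 * d) * n = ((40 + 4 * d) * n).-2.+2 by nia.
do 2!apply: run_cons.
pose st s' := [/\ nreg s' 3 = 0, narr s' KEY = c, narr s' TAB = tab & narr s' NXT = nxt].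
apply: (@run_for _ _ _ _ (fun k s' => st s' /\ listing s' (centers_below c k)
   (flatten [seq leaves c n p | p <- centers_below c k])) tb _ n) => //=.
- by rewrite !wnreg_unroll.
- by rewrite !wnreg_unroll.
- by rewrite !wnreg_unroll.
- move=> k s' kn s'20 s'0 s'4 [[s'3 sK sT sN] ls].
  have -> : tb k = (17 + 2 * d + (2 * d + 10) * size (cell c k n)).+4.+1 by rewrite /tb; lia.
  do 4!apply: run_cons.
  rewrite centers_belowS.
  apply: run_if => /=; rewrite s'3 sK s'20 => h.
    apply: run_skip; first by lia.
    by rewrite ifN //; apply/eqP; lia.
  have ck : c k = k by lia.
  rewrite ck eqxx map_rcons flatten_rcons.
  set s1 := set_nreg _ _ _.
  have ls1 : listing s1 (centers_below c k) (flatten [seq leaves c n p | p <- centers_below c k]).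
    by case: ls => a [b1 b2] [b3 b4]; split.
  apply: (@run_mid _ _ _ _ (2 * d + 2) ((2 * d + 10) * size (cell c k n) + 12) _ _ _
    (@emit_spec s1 1 20 _ _ k isT isT s'20 s'4 ls1)); last by lia.
  move=> s2; rewrite eqxx => ls2 [f1 _ f3 _].
  have [h0 h3] : nreg s2 0 = n /\ nreg s2 3 = 0 by rewrite !f1 //= wnreg_unroll.
  have [h20 h4] : nreg s2 20 = k /\ nreg s2 4 = 1 by rewrite !f1 //= wnreg_unroll.
  have [hK hT hN] : [/\ narr s2 KEY = c, narr s2 TAB = tab & narr s2 NXT = nxt].
    by rewrite !f3 //= wnarr_unroll.
  rewrite addnS; apply: run_cons; set u3 := step _ _.
  apply: (@run_mid _ _ _ _ 10 ((2 * d + 10) * size (cell c k n) + 1) _ _ _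
      (@lookup_spec _ 0 u3 n n k c nxt _ _ _ _ _ _ _ _)) => //; last by lia.
    by rewrite /= hT.
  move=> s5 lk [e1 _ e3 e4].
  have g0 : nreg s5 0 = n by rewrite (e1 0 isT).
  apply: (@run_list _ _ _ _ _ nxt n (fun l s' => [/\ st s', nreg s' 20 = k, nreg s' 4 = 1 &
     exists2 l0, cell c k n = l0 ++ l & listing s' (rcons (centers_below c k) k)
       (flatten [seq leaves c n p | p <- centers_below c k] ++ [seq q <- l0 | q != k])])
     (cell c k n) _ (2 * d + 8)) => //=.
  + by rewrite !wnreg_unroll.
  + by rewrite !wnreg_unroll.
  + by rewrite !wnarr_unroll.
  + by rewrite (e3 NXT isT).
  + split; rewrite ?(e1 20 isT) ?(e1 4 isT) //.
      by split; rewrite ?(e1 3 isT) ?(e3 KEY isT) ?(e3 TAB isT) ?(e3 NXT isT).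
    exists [::] => //; rewrite cats0; case: ls2 => a [b1 b2] [b3 b4].
    split; [move=> j jd | split | split]; rewrite ?(e4 _ isT) ?(e1 1 isT) ?(e1 2 isT) //.
    * exact: a.
    * by move=> i j; rewrite (e4 _ isT); exact: b2.
    * by move=> i j; rewrite (e4 _ isT); exact: b4.
  + move=> a l t t6 _ _ _ [[t3 tK tT tN] t20 t4 [l0 cE ls3]].
    rewrite [_ + 8](_ : _ = (2 * d + 4).+4); last by lia.
    do 3!apply: run_cons.
    set t' := step _ _; have ls' : listing t' (rcons (centers_below c k) k)
       (flatten [seq leaves c n p | p <- centers_below c k] ++ [seq q <- l0 | q != k]).
      by case: ls3 => b0 [b1 b2] [b3 b4]; split.
    apply: run_if => /=; rewrite t3 t6 t20 => ne.
      apply: (run_use (@emit_spec t' 2 6 _ _ a isT isT t6 t4 ls')); first by lia.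
      move=> t2; rewrite /= => ls4 [p1 _ p3 _].
      split; rewrite ?p1 ?p3 //= ?wnreg_unroll //.
        by split; rewrite ?p1 ?p3 //= ?wnreg_unroll ?wnarr_unroll.
      exists (rcons l0 a); first by rewrite cat_rcons.
      by rewrite filter_rcons ifT -?rcons_cat //; apply/eqP; lia.
    apply: run_skip; first by lia.
    split=> //; exists (rcons l0 a); first by rewrite cat_rcons.
    by rewrite filter_rcons ifN //; apply/negP => /eqP; lia.
  + by rewrite mulnC; lia.
  + move=> t [[t3 tK tT tN] _ _ [l0 cE ls3]]; split=> //.
    by move: cE; rewrite cats0 => cE; rewrite /leaves cE -cats1 in ls3 *.
- by move=> s' [].
Qed.

End Output.

(** * Optimality *)

Section NearestNeighbours.
Local Open Scope nat_scope.
Variables (R : realType) (d n : nat) (x : nat -> nat -> R).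

Lemma sqdC p q : sqd d x p q = sqd d x q p.
Proof. by apply: eq_bigr => j _; rewrite -opprB sqrrN. Qed.

Lemma max_nn_exists : 1 < n -> exists D, max_nn d n x D.
Proof.
move=> n1; have n0 : 0 < n by exact: ltnW.
pose other (p : 'I_n) : 'I_n := if val p == 0 then Ordinal n1 else Ordinal n0.
have otherP p : other p != p by rewrite /other -val_eqE; case: (eqVneq (val p) 0) => [->|]; rewrite //= eq_sym.
pose nn (p : 'I_n) := [arg min_(q < other p | q != p) sqd d x p q]%O.
have nnP p : nn p != p /\ forall q : 'I_n, q != p -> (sqd d x p (nn p) <= sqd d x p q)%R.
  by rewrite /nn; case: arg_minP => // q qp h; split.
pose m (p : 'I_n) := sqd d x p (nn p).
pose pm := [arg max_(p > Ordinal n0) m p]%O.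
have pmP p : (m p <= m pm)%R by rewrite /pm; case: arg_maxP => // q _ h; exact: h.
exists (m pm); split=> [p pn|].
  have [h _] := nnP (Ordinal pn); exists (nn (Ordinal pn)); split=> //; last exact: (pmP (Ordinal pn)).
  by move=> e; move: h; rewrite -val_eqE /= e eqxx.
exists (val pm); first exact: ltn_ord.
move=> q qn qp; have [_ h] := nnP pm.
by apply: (h (Ordinal qn)); rewrite -val_eqE; exact/eqP.
Qed.

Lemma max_nn_gt0 D : distinct d n x -> max_nn d n x D -> (0 < D)%R.
Proof.
move=> dist [D1 [p pn _]]; have [q [qn qp le]] := D1 p pn.
by apply: lt_le_trans le; apply: dist => // e; exact: qp.
Qed.

End NearestNeighbours.

Section Frechet.
Variables (R : realType) (d : nat) (S : {fset 'rV[R]_d}) (pts : seq 'rV[R]_d).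
Hypotheses (Sp : pts =i S) (up : uniq pts).
Local Notation n := (size pts).
Local Notation pt := (nth 0 pts).
Let x (j i : nat) : R := if insub j is Some j' then pt i 0 j' else 0.

Lemma edistE p q : Defs.edist (pt p) (pt q) = Num.sqrt (sqd d x p q).
Proof. by congr Num.sqrt; apply: eq_bigr => j _; rewrite /x valK. Qed.

Lemma edistC (u v : 'rV[R]_d) : Defs.edist u v = Defs.edist v u.
Proof. by congr Num.sqrt; apply: eq_bigr => j _; rewrite -opprB sqrrN. Qed.

Lemma distinct_pts : distinct d n x.
Proof.
move=> p q pn qn pq; rewrite lt_neqAle sumr_ge0 ?andbT => [|j _]; last exact: sqr_ge0.
apply/eqP => /esym /eqP; rewrite psumr_eq0 => [/allP h|j _]; last exact: sqr_ge0.
apply: pq; apply/eqP; rewrite -(nth_uniq 0 pn qn up); apply/eqP/rowP => j.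
by have := h j (mem_index_enum _); rewrite /x valK sqrf_eq0 subr_eq0 => /eqP.
Qed.

Variable D : R.
Hypothesis opt : max_nn d n x D.

Lemma le_bigmax_mem (I : eqType) (r : seq I) (F : I -> R) i y :
  i \in r -> y <= F i -> y <= \big[Num.max/0]_(k <- r) F k.
Proof.
elim: r => //= k r IH; rewrite inE big_cons le_max => /orP[/eqP<- -> //|ir yF].
by rewrite (IH ir yF) orbT.
Qed.

Lemma walk_cost_ge (P Q : seq 'rV[R]_d) w b p q : paired_walk P Q w -> b \in w -> p \in b.1 -> q \in b.2 ->
  Defs.edist p q <= walk_cost w.
Proof.
move=> _ bw pb qb; apply: (le_bigmax_mem bw); apply: (le_bigmax_mem pb).
exact: le_bigmax_mem qb (lexx _).
Qed.

Lemma dF_lower P Q : curves_partition S P Q -> Num.sqrt D <= dF P Q.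
Proof.
move=> [P0 Q0 [A [B [SE AB [PA _] [QB _]]]]].
have [_ [p pn D2]] := opt.
have [[w ww <-] _] := dF_min P0 Q0.
have far q : q \in S -> q != pt p -> Num.sqrt D <= Defs.edist (pt p) q.
  rewrite -Sp => qS qp; rewrite -(nth_index 0 qS) edistE.
  rewrite ler_sqrt; last by apply: sumr_ge0 => j _; exact: sqr_ge0.
  apply: D2; first by rewrite index_mem.
  by move=> e; move: qp; rewrite -(nth_index 0 qS) e eqxx.
have inP u : u \in P -> u \in S by rewrite PA SE in_fsetU => ->.
have inQ u : u \in Q -> u \in S by rewrite QB SE in_fsetU => ->; rewrite orbT.
have disj u v : u \in P -> v \in Q -> u != v.
  move=> uP vQ; apply/eqP => e; have : u \in (A `&` B)%fset by rewrite in_fsetI -PA uP -QB e.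
  by rewrite AB in_fset0.
have [wP wQ wb] := ww.
have bP b u : b \in w -> u \in b.1 -> u \in P.
  by move=> bw ub; rewrite -wP; apply/flattenP; exists b.1 => //; exact: map_f.
have bQ b u : b \in w -> u \in b.2 -> u \in Q.
  by move=> bw ub; rewrite -wQ; apply/flattenP; exists b.2 => //; exact: map_f.
have : pt p \in S by rewrite -Sp mem_nth.
rewrite SE in_fsetU -PA -QB -{1}wP -{1}wQ => /orP[]/flattenP[l /mapP[b bw ->] pb].
  have [_ + _] := wb b bw; case E : b.2 => [//|q l'] _.
  have qb : q \in b.2 by rewrite E mem_head.
  apply: le_trans (walk_cost_ge ww bw pb qb); apply: far; first exact: inQ (bQ _ _ bw qb).
  by rewrite eq_sym; apply: disj; [exact: bP bw pb | exact: bQ bw qb].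
have [+ _ _] := wb b bw; case E : b.1 => [//|q l'] _.
have qb : q \in b.1 by rewrite E mem_head.
apply: le_trans (walk_cost_ge ww bw qb pb); rewrite edistC; apply: far; first exact: inP (bP _ _ bw qb).
by apply: disj; [exact: bP bw qb | exact: bQ bw pb].
Qed.

Variables (f c : nat -> nat).
Hypothesis n0 : (0 < n)%N.
Hypothesis fD : forall p, (p < n)%N -> [/\ (f p < n)%N, f p <> p & sqd d x p (f p) <= D].
Hypothesis cs : star_centers n f c.

Let C := centers_below c n.
Let L := flatten [seq leaves c n p | p <- C].

Lemma mem_centers p : (p \in C) = (p < n)%N && (c p == p).
Proof. by rewrite mem_filter mem_iota andbC. Qed.

Lemma mem_leaves p q : (q \in leaves c n p) = [&& (q < n)%N, c q == p & q != p].
Proof. by rewrite mem_filter cellE andbC andbA. Qed.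

Lemma mem_all_leaves q : (q \in L) = (q < n)%N && (c q != q).
Proof.
have [clt cc _ _] := cs.
apply/flattenP/andP => [[_ /mapP[p _ ->]]|[qn cq]].
  by rewrite mem_leaves => /and3P[qn /eqP-> qp]; rewrite eq_sym.
exists (leaves c n (c q)); last by rewrite mem_leaves qn eqxx eq_sym.
by apply: map_f; rewrite mem_centers clt // cc ?eqxx.
Qed.

Lemma uniq_all_leaves : uniq L.
Proof.
have : uniq C by rewrite filter_uniq ?iota_uniq.
rewrite /L; elim: C => //= p l IH /andP[pl ul]; rewrite cat_uniq IH // andbT.
rewrite filter_uniq ?cell_uniq //=; apply/hasPn => q /flattenP[_ /mapP[p' p'l ->]].
rewrite !mem_leaves => /and3P[_ /eqP cq _]; rewrite cq.
by apply/negP => /and3P[_ /eqP e _]; rewrite -e p'l in pl.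
Qed.

Lemma leaves_neq0 p : p \in C -> leaves c n p != [::].
Proof.
rewrite mem_centers => /andP[pn /eqP cp]; have [_ _ _ h] := cs.
have [q qn [/eqP qp /eqP cq]] := h p pn cp.
by apply/eqP => e; have : q \in leaves c n p; [rewrite mem_leaves qn cq | rewrite e].
Qed.

Lemma stars_partition : curves_partition S [seq pt p | p <- C] [seq pt p | p <- L].
Proof.
have [clt cc _ h] := cs.
have pt_inj l : {subset l <= gtn n} -> uniq l -> uniq [seq pt p | p <- l].
  move=> ln ul; rewrite map_inj_in_uniq // => p q pl ql /eqP.
  by rewrite nth_uniq //; [move/eqP | exact: ln | exact: ln].
have Cn : {subset C <= gtn n} by move=> p; rewrite mem_centers => /andP[].
have Ln : {subset L <= gtn n} by move=> p; rewrite mem_all_leaves => /andP[].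
have c0 : c 0 \in C by rewrite mem_centers clt // cc ?eqxx.
have [q qn [qc cq]] := h _ (clt _ n0) (cc _ n0).
have qL : q \in L by rewrite mem_all_leaves qn cq eq_sym; apply/eqP.
split.
- by move: c0; case: C.
- by move: qL; case: L.
exists [fset u in [seq pt p | p <- C]]%fset, [fset u in [seq pt p | p <- L]]%fset; split.
- apply/fsetP => u; rewrite -Sp in_fsetU !in_fset; apply/idP/orP => [uS|].
    have un : (index u pts < n)%N by rewrite index_mem.
    case: (eqVneq (c (index u pts)) (index u pts)) => e; [left|right];
      apply/mapP; exists (index u pts); rewrite ?nth_index //.
      by rewrite mem_centers un e eqxx.
    by rewrite mem_all_leaves un e.
  by case=> /mapP[p pC ->]; rewrite mem_nth //; [exact: Cn | exact: Ln].
- apply/fsetP => u; rewrite in_fsetI !in_fset in_fset0; apply/negP => /andP[/mapP[p pC ->] /mapP[q' qL' /eqP]].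
  rewrite nth_uniq //; [|exact: Cn|exact: Ln] => /eqP pq.
  move: pC qL'; rewrite -pq mem_centers mem_all_leaves => /andP[_ /eqP->].
  by rewrite eqxx andbF.
- split; last by apply: pt_inj => //; rewrite filter_uniq ?iota_uniq.
  by move=> u; rewrite in_fset.
- split; last by apply: pt_inj => //; exact: uniq_all_leaves.
  by move=> u; rewrite in_fset.
Qed.

Lemma dF_upper : dF [seq pt p | p <- C] [seq pt p | p <- L] <= Num.sqrt D.
Proof.
have [P0 Q0 _] := stars_partition; have [_ min] := dF_min P0 Q0.
(* [L] lists the leaves in the order of their centres, so every star is a contiguous block of both
   curves, with a single vertex on the first. *)
pose w := [seq ([:: pt p], [seq pt q | q <- leaves c n p]) | p <- C].
have ww : paired_walk [seq pt p | p <- C] [seq pt p | p <- L] w.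
  split.
  - rewrite -map_comp /=; elim: C => //= p l ->; exact: erefl.
  - by rewrite -map_comp /L map_flatten -map_comp.
  - move=> b /mapP[p pC ->]; split=> //=.
    by have := leaves_neq0 pC; case: (leaves c n p).
apply: le_trans (min w ww) _; have D0 := max_nn_gt0 distinct_pts opt.
have ge0 : 0 <= Num.sqrt D by exact: sqrtr_ge0.
rewrite /walk_cost big_seq; apply: bigmax_le => // b /mapP[p pC ->] /=.
rewrite big_cons big_nil ge_max ge0 andbT big_seq; apply: bigmax_le => // u /mapP[q + ->].
rewrite mem_leaves => /and3P[qn /eqP cq qp].
rewrite edistE ler_sqrt; last exact: ltW.
have [clt _ h _] := cs; have pn : (p < n)%N by rewrite -cq clt.
case: (h q qn); rewrite cq; first by move=> e; rewrite e eqxx in qp.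
  by move=> ->; rewrite sqdC; case: (fD qn).
by move=> fp; case: (fD pn); rewrite fp.
Qed.

End Frechet.

(** * Running time and assembly *)

Lemma up_log_bound (R : realType) (n : nat) : (1 < n)%N ->
  (up_log 2 n).+1%:R * ln 2 <= 3 * ln n%:R :> R.
Proof.
move=> n1; have h := @up_log_gtn 2 n isT n1; have l0 : 0 < ln 2 :> R by rewrite ln_gt0 // ltr1n.
have u0 : (0 < up_log 2 n)%N by rewrite up_log_gt0.
have h1 : (up_log 2 n).-1%:R * ln 2 <= ln n%:R :> R.
  rewrite mulr_natl -lnXn ?ltr0n // ler_ln ?posrE ?exprn_gt0 ?ltr0n //; last exact: ltnW.
  by rewrite -natrX ler_nat ltnW.
have h2 : ln 2 <= ln n%:R :> R by rewrite ler_ln ?posrE ?ltr0n ?ler_nat //; exact: ltnW.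
(* The factor 3 is 1 from [h1], where the logarithm before rounding up the last step is at most that
   of n, plus 2 from [h2], applied to the two remaining units. *)
have -> : (up_log 2 n).+1 = (up_log 2 n).-1.+2 by rewrite prednK.
by rewrite -[X in X%:R]addn2 natrD mulrDl; lra.
Qed.

Lemma nlogn_bigO (R : realType) (C : nat) :
  (fun n : nat => (C * (n * (up_log 2 n).+1))%:R : R^o)
     =O_\oo (fun n : nat => n%:R * ln n%:R : R^o).
Proof.
have l0 : 0 < ln 2 :> R by rewrite ln_gt0 // ltr1n.
(* The summand 1 keeps the constant positive when C = 0. *)
apply/eqO_exP; exists ((C%:R + 1) * (3 / ln 2)).
  by rewrite mulr_gt0 ?divr_gt0 // ltr_wpDl.
near=> n; have n1 : (1 < n)%N by near: n; exists 2.
have ln0 : 0 <= ln n%:R :> R by rewrite ln_ge0 // ler1n ltnW.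
rewrite !ger0_norm ?mulr_ge0 ?ler0n //.
have h := up_log_bound R n1; rewrite -ler_pdivlMr // in h.
rewrite !natrM mulrA [leRHS]mulrACA.
apply: ler_pM; rewrite ?mulr_ge0 ?ler0n //; first by rewrite ler_wpM2r ?ler0n // lerDl.
by rewrite mulrAC.
Unshelve. all: by end_near.
Qed.

Section Solve.
Local Open Scope nat_scope.
Variables (R : realType) (d : nat).

Definition solve : cmd := partners d ;; stars ;; insert ;; output d.

Definition solve_time n := (partners_time d + 150 + 4 * d) * (n * (up_log 2 n).+1).

Lemma sqd_ext x x' p q : (forall j, j < d -> x j p = x' j p /\ x j q = x' j q) ->
  sqd d x p q = sqd d x' p q :> R.
Proof. by move=> h; apply: eq_bigr => j _; have [-> ->] := h j (ltn_ord j). Qed.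

Lemma solve_spec (s : state R) n D : 0 < d -> nreg s 0 = n -> 0 < n -> (0 < D)%R ->
  max_nn d n (rarr s) D ->
  run solve s (solve_time n) (fun s' => exists f c,
    [/\ forall p, p < n -> [/\ f p < n, f p <> p & (sqd d (rarr s) p (f p) <= D)%R],
      star_centers n f c &
      listing d (rarr s) s' (centers_below c n) (flatten [seq leaves c n p | p <- centers_below c n])]).
Proof.
move=> d0 s0 n0 D0 opt; have ne : n <= 2 ^ up_log 2 n by exact: up_logP.
apply: (@run_mid _ _ _ _ (partners_time d * (n * (up_log 2 n).+1)) (50 * n + (n * 15 + 2 + (40 + 4 * d) * n)) _ _ _
  (partners_spec s0 n0 d0 ne D0 opt)); last by rewrite /solve_time; nia.
move=> s1 [a0 a3 a4 ax fD] _; set f := narr s1 PTN in fD.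
have flt p : p < n -> f p < n by case/fD.
have fne p : p < n -> f p <> p by case/fD.
apply: (@run_mid _ _ _ _ (50 * n) _ _ _ _ (@stars_spec R n f flt fne s1 a0 a3 a4 (erefl f) n0)); last exact: leqnn.
move=> s2; set c := narr s2 KEY => cs [f1 _ _ f4].
have b0 : nreg s2 0 = n by rewrite (f1 0 isT).
have b3 : nreg s2 3 = 0 by rewrite (f1 3 isT).
have b4 : nreg s2 4 = 1 by rewrite (f1 4 isT).
apply: (@run_mid _ _ _ _ (n * 15 + 2) _ _ _ _ (@insert_spec R s2 n c b0 b3 b4 (erefl c))); last exact: leqnn.
move=> s3 ch [g1 _ g3 g4].
apply: (run_use (@output_spec R d (rarr s) s3 n c _ _ _ _ n0 ch _)) => //.
- by rewrite (g1 0 isT).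
- by rewrite (g1 3 isT).
- by rewrite (g1 4 isT).
- by rewrite (g3 1 isT).
- by move=> j jd; rewrite (g4 _ isT) (f4 _ isT) ax //; lia.
- by move=> s4 ls _; exists f, c.
Qed.

End Solve.

Unset Implicit Arguments.
Theorem theorem5 (R : realType) (d : nat) :
  exists (c : cmd) (T : nat -> nat),
    ((fun n : nat => (T n)%:R : R^o)
       =O_\oo (fun n : nat => n%:R * ln n%:R : R^o)) /\
    forall (S : {fset 'rV[R]_d}) (pts : seq 'rV[R]_d) (s : state R),
      (2 <= #|` S|)%N ->
      pts =i S -> uniq pts -> stores s 0 pts ->
      exists (t : nat) (s' : state R) (P Q : seq 'rV[R]_d),
        [/\ exec c s t s', (t <= T #|` S|)%N, stores s' 1 P, stores s' 2 Q &
            curves_partition S P Q /\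
            forall P' Q' : seq 'rV[R]_d,
              curves_partition S P' Q' -> dF P Q <= dF P' Q'].
Proof.
exists (solve d), (solve_time d); split; first exact: nlogn_bigO.
move=> S pts s S2 Sp up [s0 sx].
have szS : size pts = #|` S|.
  by apply/eqP; rewrite -(uniq_size_uniq (fset_uniq S) (fun u => esym (Sp u))).
have n1 : (1 < size pts)%N by rewrite szS.
have n0 : (0 < size pts)%N by exact: ltnW.
(* In dimension 0 any two points coincide. *)
have d0 : (0 < d)%N.
  rewrite lt0n; apply/eqP => d0; subst d.
  have := nth_uniq 0 n0 n1 up; rewrite (_ : nth 0 pts 0 = nth 0 pts 1) ?eqxx //.
  by apply/rowP => -[].
set n := size pts in s0 n1 n0.
(* Memory beyond the n stored points is unspecified, so the optimum is taken for coordinates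
   completed by 0 and then carried over to the arrays. *)
pose x (j i : nat) : R := if insub j is Some j' then nth 0 pts i 0 j' else 0.
have xE j i : (j < d)%N -> (i < n)%N -> rarr s j i = x j i.
  move=> jd lt; have := sx i (Ordinal jd) lt; rewrite mul0n add0n /= => ->.
  by rewrite /x insubT.
have sqdE p q : (p < n)%N -> (q < n)%N -> sqd d (rarr s) p q = sqd d x p q.
  by move=> pn qn; apply: sqd_ext => j jd; rewrite !xE.
have [D opt] := @max_nn_exists R d n x n1.
have D0 := max_nn_gt0 (distinct_pts up) opt.
have opt' : max_nn d n (rarr s) D.
  have [h [p pn h']] := opt; split.
    by move=> p' p'n; have [q [qn qp le]] := h p' p'n; exists q; rewrite sqdE.
  by exists p => // q qn qp; rewrite sqdE //; exact: h'.
have [t [s' [ex le [f [c [fD cs [_ [n1' a1] [n2' a2]]]]]]]] := solve_spec d0 s0 n0 D0 opt'.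
have fD' p : (p < n)%N -> [/\ (f p < n)%N, f p <> p & sqd d x p (f p) <= D].
  by move=> pn; have [fn fp le'] := fD p pn; rewrite -sqdE.
have [C0 L0 part] := stars_partition Sp up n0 cs.
exists t, s', [seq nth 0 pts p | p <- centers_below c n],
  [seq nth 0 pts p | p <- flatten [seq leaves c n p | p <- centers_below c n]].
have stored k l : (nreg s' k = size l) -> {subset l <= gtn n} ->
    (forall i j, (i < size l)%N -> (j < d)%N -> rarr s' (k * d + j)%N i = rarr s j (nth 0%N l i)) ->
    stores s' k [seq nth 0 pts p | p <- l].
  move=> kl ln h; split; rewrite size_map // => i j il.
  rewrite h // (nth_map 0%N) // xE //; first by rewrite /x valK.
  exact: ln (mem_nth _ il).
split=> //; rewrite -?szS //.
- by apply: stored => // p; rewrite mem_centers => /andP[].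
- by apply: stored => // p; rewrite (mem_all_leaves cs) => /andP[].
split=> [|P' Q' PQ]; first exact: (stars_partition Sp up n0 cs).
by apply: le_trans (dF_upper Sp up opt n0 fD' cs) (dF_lower Sp opt PQ).
Qed.
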